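(* Let $T$ be a theory with JCP, $\mathfrak M$ a monster model of $T$, and $\mathcal E$ a set of type-definable equivalence relations. Then $T$ is stable if and only if $T^{\mathcal E}$ is stable.
   Context: Positive logic: formulas are built from atomic formulas with $\top,\bot,\wedge,\vee,\exists$; a theory is a consistent set of h-inductive sentences $\forall x(\phi\to\psi)$ with $\phi,\psi$ positive; p.c. models are models such that every homomorphism from them into a model of the theory reflects positive formulas; JCP means any two models map homomorphically into a common model. $\mathfrak M$ is a monster model of $T$: a very saturated, very homogeneous p.c. model. Let $\mathcal L$ be the signature of $T$. A type-definable equivalence relation is a set $E(x,y)$ of positive $\mathcal L$-formulas without parameters, $x,y$ small tuples of variables of matching sorts, defining an equivalence relation on $\mathfrak M$. $\mathcal L_{\mathcal E}$ extends $\mathcal L$ by a sort $S_E$ for each $E\in\mathcal E$ and, for each finite tuple of variables $x$ (real or new sorts) and each $\mathcal L$-formula $\phi(x_r)$, a relation symbol $R_\phi(x)$, where $x_r$ replaces each variable of sort $S_E$ by a tuple of real variables matching $E$. $\mathfrak M^{\mathcal E}$ expands $\mathfrak M$ by interpreting $S_E$ as the set of $E$-classes and $R_\phi(c)$ as: some tuple of representatives of $c$ satisfies $\phi$ in $\mathfrak M$. $T^{\mathcal E}$ is the set of h-inductive $\mathcal L_{\mathcal E}$-sentences true in $\mathfrak M^{\mathcal E}$, and properties of $T^{\mathcal E}$ are evaluated in $\mathfrak M^{\mathcal E}$ (its monster model). For a theory $S$ with monster model $\mathfrak N$ and an infinite cardinal $\lambda$: $S$ is $\lambda$-stable if for every parameter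 set $B\subseteq\mathfrak N$ with $|B|\le\lambda$ and every finite tuple of variables, there are at most $\lambda$ types over $B$ in those variables (a type over $B$ being the set of positive formulas with parameters in $B$ satisfied by some tuple of $\mathfrak N$); $S$ is stable if it is $\lambda$-stable for some $\lambda$. *)

(* Defs.v *)
From mathcomp Require Import all_boot.
From mathcomp Require Import boolp classical_sets cardinality.
From Stdlib Require Export RelationClasses.

Set Implicit Arguments.
Unset Strict Implicit.
Unset Printing Implicit Defensive.

Local Open Scope classical_set_scope.
Local Open Scope card_scope.

Definition small (K A : Type) : Prop :=
  [set: A] #<= [set: K] /\ ~ ([set: K] #<= [set: A]).

Definition strong_limit (K : Type) : Prop :=
  small K nat /\ forall A : Type, small K A -> small K (set A).

Record signature := Signature {
  lsort : Type;
  lfunc : Type;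
  far : lfunc -> nat;
  fsort : forall f : lfunc, 'I_(far f) -> lsort;
  fcod : lfunc -> lsort;
  lrel : Type;
  rar : lrel -> nat;
  rsort : forall r : lrel, 'I_(rar r) -> lsort
}.

(* A possibly infinite tuple of sorted variables. Each formula over it only
   involves finitely many of them. *)
Record ctx (S : Type) := Ctx { var :> Type; vsort : var -> S }.

Definition fctx (S : Type) (n : nat) (s : 'I_n -> S) : ctx S := Ctx s.

Definition ctx_ext (S : Type) (V : ctx S) (s : S) : ctx S :=
  @Ctx S (option V) (fun o => if o is Some v then vsort v else s).

Definition ctx_sum (S : Type) (V W : ctx S) : ctx S :=
  @Ctx S (V + W)%type
    (fun z => match z with inl v => vsort v | inr w => vsort w end).

Section Syntax.
Variable L : signature.

Inductive term (V : ctx (lsort L)) : lsort L -> Type :=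
| TVar (v : V) : term V (vsort v)
| TFun (f : lfunc L) :
    (forall i : 'I_(far f), term V (fsort i)) -> term V (fcod f).

Inductive pform (V : ctx (lsort L)) : Type :=
| PTop
| PBot
| PEq (s : lsort L) (t u : term V s)
| PRel (r : lrel L) (t : forall i : 'I_(rar r), term V (rsort i))
| PAnd (phi psi : pform V)
| POr (phi psi : pform V)
| PEx (s : lsort L) (phi : pform (ctx_ext V s)).

(* The h-inductive sentence "for all x, hprem x -> hconcl x". *)
Record hsentence := HSentence {
  hlen : nat;
  hsort : 'I_hlen -> lsort L;
  hprem : pform (fctx hsort);
  hconcl : pform (fctx hsort)
}.

Record structure := Structure {
  dom :> lsort L -> Type;
  fint : forall f : lfunc L,
    (forall i : 'I_(far f), dom (fsort i)) -> dom (fcod f);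
  rint : forall r : lrel L, (forall i : 'I_(rar r), dom (rsort i)) -> Prop
}.

Definition tuple_in (V : ctx (lsort L)) (M : structure) : Type :=
  forall v : V, M (vsort v).

Definition tuple_ext (M : structure) (V : ctx (lsort L)) (a : tuple_in V M)
    (s : lsort L) (d : M s) : tuple_in (ctx_ext V s) M :=
  fun o => match o return M (vsort (c := ctx_ext V s) o) with
           | Some v => a v
           | None => d
           end.

Definition tuple_sum (M : structure) (V W : ctx (lsort L))
    (a : tuple_in V M) (b : tuple_in W M) : tuple_in (ctx_sum V W) M :=
  fun z => match z return M (vsort (c := ctx_sum V W) z) with
           | inl v => a v
           | inr w => b w
           end.

Fixpoint eval (M : structure) (V : ctx (lsort L)) (a : tuple_in V M)
    (s : lsort L) (t : term V s) : M s :=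
  match t in term _ s return M s with
  | TVar v => a v
  | TFun f t => fint (fun i => eval a (t i))
  end.

Fixpoint sat (M : structure) (V : ctx (lsort L)) (phi : pform V) :
    tuple_in V M -> Prop :=
  match phi with
  | PTop => fun=> True
  | PBot => fun=> False
  | PEq s t u => fun a => eval a t = eval a u
  | PRel r t => fun a => rint (fun i => eval a (t i))
  | PAnd phi psi => fun a => sat phi a /\ sat psi a
  | POr phi psi => fun a => sat phi a \/ sat psi a
  | PEx s phi => fun a => exists d : M s, sat phi (tuple_ext a d)
  end.

Definition holds (M : structure) (h : hsentence) : Prop :=
  forall a : tuple_in (fctx (@hsort h)) M, sat (hprem h) a -> sat (hconcl h) a.

Definition satisfies (M : structure) (T : set hsentence) : Prop :=
  forall h, T h -> holds M h.

Record theory := Theory {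
  axioms :> set hsentence;
  consistent : exists M : structure, satisfies M axioms
}.

Record hom (M N : structure) := Hom {
  hmap :> forall s : lsort L, M s -> N s;
  hom_fint : forall (f : lfunc L) (a : forall i : 'I_(far f), M (fsort i)),
    hmap (fint a) = fint (fun i => hmap (a i));
  hom_rint : forall (r : lrel L) (a : forall i : 'I_(rar r), M (rsort i)),
    rint a -> rint (fun i => hmap (a i))
}.

Definition automorphism (M : structure) (f : hom M M) : Prop :=
  exists g : hom M M, forall s, cancel (f s) (g s) /\ cancel (g s) (f s).

Definition JCP (T : theory) : Prop :=
  forall M1 M2 : structure, satisfies M1 T -> satisfies M2 T ->
  exists N : structure, [/\ satisfies N T, inhabited (hom M1 N)
                          & inhabited (hom M2 N)].

Definition pc_model (T : theory) (M : structure) : Prop :=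
  satisfies M T /\
  forall (N : structure) (f : hom M N), satisfies N T ->
  forall (n : nat) (s : 'I_n -> lsort L) (phi : pform (fctx s))
    (a : tuple_in (fctx s) M),
  sat phi (fun v => f _ (a v)) -> sat phi a.

Definition elem (M : structure) : Type := {s : lsort L & M s}.

(* Each element of B is a variable, which param_val interprets by itself. *)
Definition param_ctx (M : structure) (B : set (elem M)) : ctx (lsort L) :=
  @Ctx _ (set_type B) (fun b => projT1 (sval b)).

Definition param_val (M : structure) (B : set (elem M)) :
    tuple_in (param_ctx B) M :=
  fun b => projT2 (sval b).

Definition sat_over (M : structure) (B : set (elem M)) (X : ctx (lsort L))
    (a : tuple_in X M) (phi : pform (ctx_sum X (param_ctx B))) : Prop :=
  sat phi (tuple_sum a (@param_val M B)).

Definition tp (M : structure) (B : set (elem M)) (X : ctx (lsort L))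
    (a : tuple_in X M) : set (pform (ctx_sum X (param_ctx B))) :=
  [set phi | sat_over a phi].

Definition saturated (K : Type) (M : structure) : Prop :=
  forall (X : ctx (lsort L)) (B : set (elem M)),
  small K X -> small K (set_type B) ->
  forall Sigma : set (pform (ctx_sum X (param_ctx B))),
  (forall F : set (pform (ctx_sum X (param_ctx B))),
     finite_set F -> F `<=` Sigma ->
     exists a : tuple_in X M, forall phi, F phi -> sat_over a phi) ->
  exists a : tuple_in X M, forall phi, Sigma phi -> sat_over a phi.

Definition homogeneous (K : Type) (M : structure) : Prop :=
  forall (X : ctx (lsort L)), small K X ->
  forall a b : tuple_in X M,
  (forall phi : pform X, sat phi a <-> sat phi b) ->
  exists2 f : hom M M, automorphism f & forall x : X, f _ (a x) = b x.

Definition monster (K : Type) (T : theory) (M : structure) : Prop :=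
  [/\ pc_model T M, saturated K M & homogeneous K M].

Definition card_stable (lam : Type) (N : structure) : Prop :=
  forall B : set (elem N), B #<= [set: lam] ->
  forall (n : nat) (s : 'I_n -> lsort L),
  range (@tp N B (fctx s)) #<= [set: lam].

(* Stability of S, evaluated in its monster model N of degree of saturation K.
   The cardinal lam has to be small: otherwise lam := |N| would always do. *)
Definition stable (K : Type) (S : theory) (N : structure) : Prop :=
  satisfies N S /\
  exists lam : Type,
    [/\ infinite_set [set: lam], small K lam & card_stable lam N].

Record tdrel := TDRel {
  tdctx : ctx (lsort L);
  tdform : set (pform (ctx_sum tdctx tdctx))
}.

Definition tdint (M : structure) (E : tdrel) (a b : tuple_in (tdctx E) M) :
    Prop :=
  forall phi, tdform phi -> sat phi (tuple_sum a b).

Definition tdclass (M : structure) (E : tdrel) : Type :=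
  {C : set (tuple_in (tdctx E) M) | exists a, C = [set b | tdint a b]}.

End Syntax.

Arguments tp {L M} B {X} a.

Section Hyper.
Variables (L : signature) (I : Type) (E : I -> tdrel L).

Definition hyp_sort : Type := (lsort L + I)%type.

(* The real variables replacing one variable of sort z. *)
Definition hyp_block (z : hyp_sort) : ctx (lsort L) :=
  match z with
  | inl s => @Ctx _ unit (fun=> s)
  | inr e => tdctx (E e)
  end.

(* The tuple x_r of real variables associated with x. *)
Definition hyp_real (n : nat) (x : 'I_n -> hyp_sort) : ctx (lsort L) :=
  @Ctx _ {i : 'I_n & hyp_block (x i)} (fun p => vsort (projT2 p)).

(* The index of the symbol R_phi(x). *)
Record hyp_rel := HypRel {
  hr_len : nat;
  hr_sort : 'I_hr_len -> hyp_sort;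
  hr_form : pform (hyp_real hr_sort)
}.

Definition hyp_sig : signature :=
  @Signature hyp_sort
    (lfunc L) (@far L) (fun f i => inl (fsort i)) (fun f => inl (fcod f))
    (lrel L + hyp_rel)%type
    (fun r => match r with inl r => rar r | inr R => hr_len R end)
    (fun r => match r return
                'I_(match r with inl r => rar r | inr R => hr_len R end)
                -> hyp_sort with
              | inl r => fun i => inl (rsort i)
              | inr R => @hr_sort R
              end).

Variable M : structure L.

Definition hyp_dom (z : hyp_sort) : Type :=
  match z with
  | inl s => M s
  | inr e => tdclass M (E e)
  end.

Definition represents (z : hyp_sort) :
    tuple_in (hyp_block z) M -> hyp_dom z -> Prop :=
  match z return tuple_in (hyp_block z) M -> hyp_dom z -> Prop with
  | inl s => fun a c => a tt = c
  | inr e => fun a c => sval c a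
  end.

Definition hyp_rint (R : hyp_rel)
    (c : forall i : 'I_(hr_len R), hyp_dom (hr_sort i)) : Prop :=
  exists a : tuple_in (hyp_real (@hr_sort R)) M,
    (forall i, represents
       (fun v : hyp_block (hr_sort i) =>
          a (existT (fun i => hyp_block (hr_sort i) : Type) i v)) (c i))
    /\ sat (hr_form R) a.

Definition hyp_structure : structure hyp_sig :=
  @Structure hyp_sig hyp_dom
    (fun f a => fint (s := M) (f := f) a)
    (fun r => match r return
       (forall i : 'I_(@rar hyp_sig r), hyp_dom (@rsort hyp_sig r i)) -> Prop
     with
     | inl r => fun a => rint (s := M) (r := r) a
     | inr R => @hyp_rint R
     end).

Definition hyp_axioms : set (hsentence hyp_sig) :=
  [set h | holds hyp_structure h].

Lemma hyp_consistent :
  exists N : structure hyp_sig, satisfies N hyp_axioms.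
Proof. by exists hyp_structure. Qed.

Definition hyp_theory : theory hyp_sig := Theory hyp_consistent.

End Hyper.

(* Main.v *)
Require Import Defs.
From Stdlib Require List.
From mathcomp Require Import all_boot.
From mathcomp Require Import boolp classical_sets functions cardinality.
From mathcomp Require Import wochoice filter.

(* Types over real parameters are restrictions of types of [M^E], so stability
   descends with the same cardinal.  Conversely, let [T] be [lam]-stable.  In a
       p.c.
   model the failure of a positive formula [phi] at a tuple is witnessed by a
   positive formula [psi] that contradicts [phi], so the classical two-rank
   argument applies to contradictory pairs: a binary tree of instances of
   [phi] and [psi] of suitable height has at most [lam] nodes and more than
   [lam] branches, whence the rank of each pair is finite.  A type is then
   determined by choosing, for each pair, a formula of the type of minimal
   rank.  If [W] is infinite and bounds the language and the lengths of the
   tuples, this gives at most [2^W] types of [W]-tuples over [2^W] parameters.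
   Finally, by homogeneity, the type of a tuple of classes over a set of
   classes is determined by the type of its representatives over
   representatives of the parameters, since automorphisms of [M] act on
   [M^E]. *)

Set Implicit Arguments.
Unset Strict Implicit.
Unset Printing Implicit Defensive.

Local Open Scope classical_set_scope.
Local Open Scope card_scope.

(** * Cardinals *)

Definition embeds (A B : Type) : Prop := exists f : A -> B, injective f.

Lemma embedsP (A B : Type) : [set: A] #<= [set: B] <-> embeds A B.
Proof.
split.
  move=> /card_leP[f].
  exists (fun x => val (f (SigSub (mem_set (I : [set: A] x))))) => x y /val_inj
      e.
  by have := @inj _ _ _ f _ _ (in_setT _) (in_setT _) e; case.
move=> [f fI]; have /injfunPex[g] : exists2 f : A -> B,
    set_fun [set: A] [set: B] f & set_inj [set: A] f.
  by exists f => // x y _ _; exact: fI.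
exact: inj_card_le g.
Qed.

Lemma card_le_embeds (A B : Type) (S : set A) :
  S #<= [set: B] <-> embeds (set_type S) B.
Proof.
have /card_eqPle[TS ST] := card_setT S.
by rewrite -embedsP; split; apply: card_le_trans.
Qed.

Lemma embeds_refl (A : Type) : embeds A A.
Proof. by exists id. Qed.

Lemma embeds_trans (B A C : Type) : embeds A B -> embeds B C -> embeds A C.
Proof. by move=> [f fI] [g gI]; exists (g \o f); apply: inj_comp. Qed.

Lemma embeds_sum (A B A' B' : Type) :
  embeds A A' -> embeds B B' -> embeds (A + B) (A' + B').
Proof.
move=> [f fI] [g gI].
exists (fun z => match z with inl a => inl (f a) | inr b => inr (g b) end).
by move=> [a|b] [a'|b'] // [] => [/fI|/gI] ->.
Qed.

Lemma embeds_prod (A B A' B' : Type) :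
  embeds A A' -> embeds B B' -> embeds (A * B) (A' * B').
Proof.
move=> [f fI] [g gI]; exists (fun z => (f z.1, g z.2)).
by move=> [a b] [a' b'] /= [/fI -> /gI ->].
Qed.

Lemma embeds_sum_prod (A : Type) (a b : A) : a <> b -> embeds (A + A) (A * A).
Proof.
move=> ab; exists (fun z => match z with inl x => (x, a) | inr x => (x, b) end).
by move=> [x|x] [y|y] // [-> //] e; case: ab.
Qed.

Lemma embeds_sig (A : Type) (P : A -> Prop) : embeds {x | P x} A.
Proof. by exists (@sval _ _) => -[x px] [y py] /= xy; apply: eq_exist. Qed.

Lemma embeds_set (A B : Type) : embeds A B -> embeds (set A) (set B).
Proof.
move=> [f fI]; exists (fun S => f @` S) => S S' SS'; apply/seteqP.
have aux (U U' : set A) : f @` U = f @` U' -> U `<=` U'.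
  move=> UU' x Ux; have : (f @` U') (f x) by rewrite -UU'; exists x.
  by move=> [y U'y /fI <-].
by split; apply: aux.
Qed.

Lemma embeds_set1 (A : Type) : embeds A (set A).
Proof.
exists (fun x => [set x]) => x y xy.
by have : [set y] x by rewrite -xy.
Qed.

Lemma embeds_fun_set (A B : Type) : embeds (A -> set B) (set (A * B)).
Proof.
exists (fun f => [set p | f p.1 p.2]) => f g fg; apply/funext => a.
apply/funext => b; exact: (congr1 (fun S => S (a, b)) fg).
Qed.

Lemma not_embeds_set (A : Type) : ~ embeds (set A) A.
Proof.
move=> [f fI]; pose D : set A := [set a | exists2 S, f S = a & ~ S a].
have nD : ~ D (f D) by move=> Df; case: (Df) => S /fI ->; apply.
by apply: (nD); exists D.
Qed.

Section Comparability.
Variables A B : Type.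

Let partial_inj (R : set (A * B)) := forall p q, R p -> R q ->
  (p.1 = q.1 <-> p.2 = q.2).

(** Zorn's lemma gives a maximal partial injection; if it missed a point on each side, that pair
    could be added to it. *)
Lemma embeds_total : embeds A B \/ embeds B A.
Proof.
have [|R [RI Rmax]] := @Zorn_bigcup (A * B)%type partial_inj.
  move=> F FP Ft p q [R FR Rp] [S FS Sq].
  by have [RS|SR] := Ft R S FR FS;
     [apply: (FP S) => //; exact: RS|apply: (FP R) => //; exact: SR].
have [domR|/existsNP[a na]] := pselect (forall a, exists b, R (a, b)).
  left; have [f fR] := choice domR; exists f => a a' e.
  exact/(RI _ _ (fR a) (fR a')).
have [ranR|/existsNP[b nb]] := pselect (forall b, exists a, R (a, b)).
  right; have [f fR] := choice ranR; exists f => b b' e.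
  exact/(RI _ _ (fR b) (fR b')).
have nab : ~ R (a, b) by move=> Rab; apply: na; exists b.
exfalso; apply: (Rmax (R `|` [set (a, b)])).
  split; first by move=> p; left.
  by move=> /(_ (a, b)) RS; apply/nab/RS; right.
move=> [x y] [x' y'] [Rp|[-> ->]] [Rq|[-> ->]] //=; first exact: RI Rp Rq.
- by split=> e; subst; [case: na; exists y|case: nb; exists x].
- by split=> e; subst; [case: na; exists y'|case: nb; exists x'].
Qed.

End Comparability.

Section InfiniteSquare.
Variable T : Type.

(* [G] is the graph of an injection [D * D -> D], where [D] is the set of
   points that occur in [G]. *)
Let dom (G : set (T * T * T)) (x : T) := exists z, G (x, x, z).
Let pairing (G : set (T * T * T)) :=
  [/\ forall p z z', G (p, z) -> G (p, z') -> z = z',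
      forall p p' z, G (p, z) -> G (p', z) -> p = p',
      forall x y z, G (x, y, z) -> [/\ dom G x, dom G y & dom G z]
    & forall x y, dom G x -> dom G y -> exists z, G (x, y, z)].

Let pairing_graph (E : Type) (el : E -> T) (h : E * E -> E) :
  injective el -> injective h ->
  pairing [set q | exists u v, q = (el u, el v, el (h (u, v)))].
Proof.
move=> elI hI; split.
- by move=> p z z' [u [v [-> ->]]] [u' [v' [/elI -> /elI -> ->]]].
- by move=> p p' z [u [v [-> ->]]] [u' [v' [-> /elI/hI[-> ->]]]].
- move=> x y z [u [v [-> -> ->]]].
  by split; [exists (el (h (u, u)));exists u, u|exists (el (h (v, v)));exists
      v, v|
    exists (el (h (h (u, v), h (u, v)))); exists (h (u, v)), (h (u, v))].
- move=> x y [z [u [v [-> _ _]]]] [z' [u' [v' [-> _ _]]]].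
  by exists (el (h (u, u'))), u, u'.
Qed.

(** A maximal pairing has a domain [D] such that [D * D], hence [D + D], embeds in [D]. If [D]
    embedded in its complement, the pairing would extend to a copy of [D + D]; so the complement
    embeds in [D], and [T] embeds in [D + D]. *)
Lemma embeds_square : embeds nat T -> embeds (T * T) T.
Proof.
move=> [i iI].
pose G0 : set (T * T * T) :=
  [set q | exists u v : nat, q = (i u, i v, i (pickle (u, v)))].
have G0P : pairing G0 by apply: pairing_graph => //; exact: pcan_inj pickleK.
(* Joining [G0] to every candidate keeps the copy of [nat] in the maximal graph; it supplies two
   distinct points of the domain. *)
have [|A [AP Amax]] := @Zorn_bigcup _ [set G | pairing (G `|` G0)].
  move=> F FP Ft /=; set U := \bigcup_(_ in _) _.
  have two p q : (U `|` G0) p -> (U `|` G0) q ->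
      exists G, [/\ pairing G, G `<=` U `|` G0, G p & G q].
    have sub X : F X -> X `|` G0 `<=` U `|` G0.
      by move=> FX z [Xz|]; [left; exists X|right].
    move=> [[X FX Xp]|G0p] [[Y FY Yq]|G0q].
    - have [XY|YX] := Ft X Y FX FY.
        by exists (Y `|` G0); split; [exact: FP|exact: sub|left; exact:
            XY|left].
      by exists (X `|` G0); split; [exact: FP|exact: sub|left|left; exact: YX].
    - by exists (X `|` G0); split; [exact: FP|exact: sub|left|right].
    - by exists (Y `|` G0); split; [exact: FP|exact: sub|right|left].
    - by exists G0; split => // z; right.
  split.
  - by move=> p z z' /two /[apply] -[G [[GP _ _ _] _ Gp Gq]]; exact: GP Gp Gq.
  - by move=> p p' z /two /[apply] -[G [[_ GP _ _] _ Gp Gq]]; exact: GP Gp Gq.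
  - move=> x y z Gp; have [G [[_ _ GP _] GU {}Gp _]] := two _ _ Gp Gp.
    have [[x' ?] [y' ?] [z' ?]] := GP _ _ _ Gp.
    by split; [exists x'|exists y'|exists z']; apply: GU.
  - move=> x y [x' xU] [y' yU].
    have [G [[_ _ _ GP] GU Gp Gq]] := two _ _ xU yU.
    have [||z Gz] := GP x y; [by exists x'|by exists y'|].
    by exists z; apply: GU.
move: (AP); set G := A `|` G0 => -[GF GI Gd Gt].
pose D := {x | dom G x}.
have [q qG] : exists q : D * D -> D, forall p,
    G (sval p.1, sval p.2, sval (q p)).
  suff /choice[q qP] : forall p : D * D, exists z : D,
    G (sval p.1, sval p.2, sval z) by exists q.
  move=> [[x dx] [y dy]] /=; have [z Gz] := Gt x y dx dy.
  by have [_ _ dz] := Gd _ _ _ Gz; exists (exist _ z dz).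
have qI : injective q.
  move=> [[x dx] [y dy]] [[x' dx'] [y' dy']] e.
  have /= := qG (exist _ x dx, exist _ y dy); rewrite e.
  move=> /GI /(_ (qG (exist _ x' dx', exist _ y' dy'))) [/= xx' yy'].
  by congr pair; apply: eq_exist.
have dG0 n : dom G (i n).
  by exists (i (pickle (n, n))); right; exists n, n.
have DD : embeds (D + D) D.
  apply: (@embeds_trans (D * D)); last by exists q.
  by apply: (@embeds_sum_prod _ (exist _ _ (dG0 0)) (exist _ _ (dG0 1))) =>
      -[/iI].
have [[k kI]|DC] := @embeds_total D {x | ~ dom G x}.
  pose el (z : D + D) := match z with inl d => sval d | inr d => sval (k d) end.
  have elI : injective el.
    move=> [d|d] [d'|d'] /= e.
    - by congr inl; case: d d' e => x dx [y dy] e; apply: eq_exist.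
    - by case: (svalP (k d')); rewrite -e; exact: svalP.
    - by case: (svalP (k d)); rewrite e; exact: svalP.
    - congr inr; apply: kI; case: (k d) (k d') e => x dx [y dy] e.
      exact: eq_exist.
  have [m mI] : embeds ((D + D) * (D + D)) D.
    by apply: embeds_trans (embeds_prod DD DD) _; exists q.
  (* On the first copy of [D] the new pairing continues [q]; all other pairs go to the second copy,
     which keeps [h] injective. *)
  pose h (p : (D + D) * (D + D)) : D + D := match p with
    | (inl d, inl d') => inl (q (d, d')) | _ => inr (m p) end.
  have hI : injective h.
    move=> [[a|a] [b|b]] [[a'|a'] [b'|b']] // [] => [/qI[-> ->]//|||||||||]
        /mI//.
  have GH := pairing_graph elI hI; move: GH; set H := [set _ | _] => GH.
  have subH : G `<=` H.
    move=> [[x y] z] Gz; have [dx dy dz] := Gd _ _ _ Gz.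
    exists (inl (exist _ x dx)), (inl (exist _ y dy)) => /=; congr pair.
    exact: GF Gz (qG (exist _ x dx, exist _ y dy)).
  exfalso; apply: (Amax H); last first.
    by rewrite /= (_ : H `|` G0 = H)//; apply/setUidl => z; move=> G0z;
      apply: subH; right.
  split; first by move=> z Az; apply: subH; left.
  pose d0 : D := exist _ _ (dG0 0); pose e0 : D + D := inr d0.
  move=> /(_ (el e0, el e0, el (h (e0, e0)))) HA.
  have AH : A (el e0, el e0, el (h (e0, e0))) by apply: HA; exists e0, e0.
  by apply: (svalP (k d0)); exists (el (h (e0, e0))); left.
have TD : embeds T D.
  apply: embeds_trans DD; apply: embeds_trans (embeds_sum (embeds_refl D) DC).
  exists (fun x => match pselect (dom G x) with
    | left dx => inl (exist _ x dx) | right nx => inr (exist _ x nx) end).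
  by move=> x y; case: pselect => dx; case: pselect => dy // -[].
apply: embeds_trans (embeds_prod TD TD) _.
apply: (@embeds_trans D); first by exists q.
exact: embeds_sig.
Qed.

End InfiniteSquare.

Lemma embeds_double (T : Type) : embeds nat T -> embeds (T + T) T.
Proof.
move=> natT; apply: embeds_trans (embeds_square natT); case: natT => i iI.
by apply: (@embeds_sum_prod _ (i 0) (i 1)) => /iI.
Qed.

Lemma small_embeds (K A B : Type) : embeds A B -> small K B -> small K A.
Proof.
move=> /embedsP AB [BK KB]; split; first exact: card_le_trans BK.
by move=> KA; apply: KB; apply: card_le_trans AB.
Qed.

Lemma small_sum (K A B : Type) :
  small K nat -> small K A -> small K B -> small K (A + B).
Proof.
move=> Kn KA KB.
have [C [nC AC BC KC]] : exists C,
    [/\ embeds nat C, embeds A C, embeds B C & small K C].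
  have [D [AD BD KD]] : exists D, [/\ embeds A D, embeds B D & small K D].
    by have [AB|BA] := embeds_total A B;
      [exists B|exists A]; split => //; exact: embeds_refl.
  have [nD|Dn] := embeds_total nat D; first by exists D.
  exists nat; split => //; first exact: embeds_refl.
  - exact: embeds_trans Dn.
  - exact: embeds_trans Dn.
apply: small_embeds KC; apply: embeds_trans (embeds_double nC).
exact: embeds_sum.
Qed.

Lemma small_prod (K A B : Type) :
  small K nat -> small K A -> small K B -> small K (A * B).
Proof.
move=> Kn KA KB; apply: (@small_embeds _ _ (nat + (A + B))); last first.
  exact/small_sum/small_sum.
apply: embeds_trans (embeds_square _); last by exists inl => x y [].
by apply: embeds_prod; [exists (inr \o inl)|exists (inr \o inr)] => x y [].
Qed.

(** * Positive formulas and substitution *)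

Lemma dchoice (A : Type) (B : A -> Type) (P : forall x, B x -> Prop) :
  (forall x, exists y, P x y) -> exists f : forall x, B x, forall x, P x (f x).
Proof. by move=> h; exists (fun x => sval (cid (h x))) => x; case: cid. Qed.

(** Its use is to complete values at finitely many variables to a total tuple. Injectivity of [y]
    leaves one candidate at each [q], and proof irrelevance identifies the transports. *)
Lemma dep_extend (A B : Type) (y : A -> B) (F : B -> Type)
    (d : forall i, F (y i)) : injective y ->
  (forall q, (forall i, y i <> q) -> inhabited (F q)) ->
  exists p : forall q, F q, forall i, p (y i) = d i.
Proof.
move=> yI dflt; suff /dchoice[p pP] : forall q, exists x : F q,
    forall i (e : y i = q), x = ecast z (F z) e (d i).
  by exists p => i; rewrite (pP _ i erefl).
move=> q; have [[i <-]|nq] := pselect (exists i, y i = q).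
  exists (d i) => j e; have ij := yI _ _ e; subst j.
  by rewrite (Prop_irrelevance e erefl).
have [|x] := dflt q; first by move=> i e; apply: nq; exists i.
by exists x => i e; case: nq; exists i.
Qed.

Definition subctx (S : Type) (W : ctx S) (n : nat) (y : 'I_n -> W) : ctx S :=
  fctx (fun i => vsort (y i)).

Definition subtuple (L : signature) (M : structure L) (W : ctx (lsort L))
    (b : tuple_in W M) (n : nat) (y : 'I_n -> W) : tuple_in (subctx y) M :=
  fun i => b (y i).

Arguments subtuple {L M W} b {n} y _.

Section Descent.
Variable L : signature.
Implicit Types (V W : ctx (lsort L)).

Lemma weaken_term V (s u : lsort L) (t : term V s) :
  exists t' : term (ctx_ext V u) s, forall (M : structure L)
    (a : tuple_in V M) (d : M u), eval (tuple_ext a d) t' = eval a t.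
Proof.
elim: t => [v|f t IH]; first by exists (@TVar L (ctx_ext V u) (Some v)).
by have [t' tE] := dchoice IH; exists (TFun t') => M a d /=; congr fint;
  apply/functional_extensionality_dep => i; exact: tE.
Qed.

(* Substitution, reindexing and restriction to finitely many variables only
   differ by the relation between the tuples where the two formulas are
   evaluated; taking any such relation in [descend] covers them all. *)
Definition tuple_rel V W :=
  forall M : structure L, tuple_in V M -> tuple_in W M -> Prop.

Definition expressible V W (A : tuple_rel V W) (l : seq V) :=
  forall v : V, List.In v l -> exists t : term W (vsort v),
    forall M a b, A M a b -> eval b t = a v.

Lemma descend_term V (s : lsort L) (t : term V s) :
  exists l : seq V, forall W (A : tuple_rel V W), expressible A l ->
  exists t' : term W s, forall M a b, A M a b -> eval b t' = eval a t.
Proof.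
elim: t => [v|f t /dchoice[l lP]].
  by exists [:: v] => W A /(_ v (or_introl erefl)).
exists (flatten [seq l i | i <- enum 'I_(far f)]) => W A Al.
have /dchoice[t' tE] : forall i, exists t' : term W (fsort i),
    forall M a b, A M a b -> eval b t' = eval a (t i).
  move=> i; apply: lP => v vl; apply: Al.
  elim: (enum _) (mem_enum 'I_(far f) i) => [//|j r IHr].
  rewrite in_cons /= => /orP[/eqP <-|ir]; apply/List.in_or_app; first by left.
  by right; apply: IHr.
exists (TFun t') => M a b Aab /=; congr fint.
by apply/functional_extensionality_dep => i; exact: tE.
Qed.

(** The list [l] depends on [phi] alone: only these finitely many variables have to be expressible,
    and [psi] serves all structures at once. *)
Lemma descend V (phi : pform V) :
  exists l : seq V, forall W (A : tuple_rel V W), expressible A l ->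
  exists psi : pform W, forall M a b, A M a b -> (sat psi b <-> sat phi a).
Proof.
have cat_expr U W (A : tuple_rel U W) l1 l2 : expressible A (l1 ++ l2) ->
    expressible A l1 /\ expressible A l2.
  by move=> Al; split=> v vl; apply: Al; apply/List.in_or_app; [left|right].
elim: phi => {V} [V|V|V s t u|V r t|V phi [l lP] psi [k kP]|V phi [l lP] psi [k
    kP]|V s phi [l lP]].
- by exists [::] => W A _; exists (@PTop L W).
- by exists [::] => W A _; exists (@PBot L W).
- have [l lP] := descend_term t; have [k kP] := descend_term u.
  exists (l ++ k) => W A /cat_expr[/lP[t' tE] /kP[u' uE]].
  by exists (PEq t' u') => M a b Aab /=; rewrite (tE M a b)// (uE M a b).
- have /dchoice[l lP] := fun i => descend_term (t i).
  exists (flatten [seq l i | i <- enum 'I_(rar r)]) => W A Al.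
  have /dchoice[t' tE] : forall i, exists t' : term W (rsort i),
      forall M a b, A M a b -> eval b t' = eval a (t i).
    move=> i; apply: lP => v vl; apply: Al.
    elim: (enum _) (mem_enum 'I_(rar r) i) => [//|j q IHq].
    rewrite in_cons /= => /orP[/eqP <-|ir]; apply/List.in_or_app; first by left.
    by right; apply: IHq.
  exists (PRel t') => M a b Aab /=.
  have -> // : (fun i => eval b (t' i)) = (fun i => eval a (t i)).
  by apply/functional_extensionality_dep => i; exact: tE.
- exists (l ++ k) => W A /cat_expr[/lP[phi' phiE] /kP[psi' psiE]].
  exists (PAnd phi' psi') => M a b Aab /=.
  by rewrite (propext (phiE _ _ _ Aab)) (propext (psiE _ _ _ Aab)).
- exists (l ++ k) => W A /cat_expr[/lP[phi' phiE] /kP[psi' psiE]].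
  exists (POr phi' psi') => M a b Aab /=.
  by rewrite (propext (phiE _ _ _ Aab)) (propext (psiE _ _ _ Aab)).
(* The bound variable [None] leaves the list: both tuples are extended by the same witness, so it
   translates to itself. *)
- exists (pmap id (l : seq (option V))) => W A Al.
  pose A' : tuple_rel (ctx_ext V s) (ctx_ext W s) := fun M b b' =>
    exists a a' d, [/\ A M a a', b = tuple_ext a d & b' = tuple_ext a' d].
  have [|phi' phiE] := lP _ A'.
    move=> [v|] vl; last first.
      exists (@TVar L (ctx_ext W s) None) => M b b' [a [a' [d [_ -> ->]]]] //.
    have [|t tE] := Al v.
      elim: (l) vl => [//|[w|] r IHr] /= [] //; first by case=> ->; left.
      by move=> /IHr; right.
    have [t' t'E] := weaken_term s t.
    exists t' => M b b' [a [a' [d [Aaa' -> ->]]]].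
    by rewrite t'E; exact: tE.
  exists (PEx phi') => M a b Aab /=; split=> -[d dP]; exists d;
  by apply/(phiE M (tuple_ext a d) (tuple_ext b d)) => //; exists a, b, d.
Qed.

Lemma subst_form V W (phi : pform V) (r : forall v : V, term W (vsort v)) :
  exists psi : pform W, forall (M : structure L) (b : tuple_in W M),
    sat psi b <-> sat phi (fun v => eval b (r v)).
Proof.
have [l lP] := descend phi.
have [|psi psiE] := lP W (fun M a b => a = fun v => eval b (r v)).
  by move=> v _; exists (r v) => M a b ->.
by exists psi => M b; exact: psiE.
Qed.

Lemma subst_sum X Y W (phi : pform (ctx_sum X Y))
    (r : forall v : X, term W (vsort v)) (q : forall v : Y, term W (vsort v)) :
  exists psi : pform W, forall (M : structure L) (b : tuple_in W M),
    sat psi b <->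
    sat phi (tuple_sum (fun v => eval b (r v)) (fun v => eval b (q v))).
Proof.
have [psi psiE] := subst_form phi (fun v : (X + Y)%type =>
  match v return term W (vsort (c := ctx_sum X Y) v) with
  | inl x => r x | inr y => q y end).
exists psi => M b; rewrite psiE.
have -> // : (fun v => eval b (match v return term W (vsort (c := ctx_sum X Y)
    v)
    with inl x => r x | inr y => q y end)) =
  tuple_sum (fun v => eval b (r v)) (fun v => eval b (q v)).
by apply/functional_extensionality_dep; case.
Qed.

(** Repetitions are removed from the list of [descend] to make [y] injective, so that values at
    these variables can later be extended to all of [W] by [dep_extend]. *)
Lemma finite_support V W (phi : pform (ctx_sum V W)) :
  exists (n : nat) (y : 'I_n -> W)
    (psi : pform (ctx_sum V (subctx y))), injective y /\
  forall M (a : tuple_in V M) (b : tuple_in W M),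
    sat psi (tuple_sum a (subtuple b y)) <-> sat phi (tuple_sum a b).
Proof.
have [l lP] := descend phi.
pose k : seq {classic W} :=
  undup (pmap (fun z => if z is inr w then Some (w : {classic W}) else None) l).
pose y (i : 'I_(size k)) : W := tnth (in_tuple k) i.
have yI : injective y.
  move=> i j; have w0 : {classic W} := y i; rewrite /y !(tnth_nth w0) /= => e.
  by apply/val_inj/eqP; rewrite -(nth_uniq w0 (s := k)) ?undup_uniq ?ltn_ord//
      e.
pose A : tuple_rel (ctx_sum V W) (ctx_sum V (subctx y)) :=
  fun M c d => exists a b, c = tuple_sum a b /\ d = tuple_sum a (subtuple b y).
have [|psi psiE] := lP _ A.
  move=> [v|w] zl.
    by exists (@TVar L (ctx_sum V (subctx y)) (inl v)) => M _ _ [a [b [-> ->]]].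
  have [i <-] : exists i, y i = w.
    have : (w : {classic W}) \in k.
      rewrite mem_undup; elim: (l) zl => [//|[v|u] r IHr] /=.
        by case=> // /IHr.
      by rewrite in_cons => -[[->]|/IHr ->]; rewrite ?eqxx ?orbT.
    by move=> /(nthP (w : {classic W}))[i ik e]; exists (Ordinal ik);
      rewrite /y (tnth_nth (w : {classic W})).
  by exists (@TVar L (ctx_sum V (subctx y)) (inr i)) => M _ _ [a [b [-> ->]]].
by exists (size k), y, psi; split => // M a b; apply: psiE; exists a, b.
Qed.

(** The variable [ord0] is bound innermost, and the induction hypothesis binds those reached by
    [lift ord0]. *)
Lemma exists_block V (n : nat) (s : 'I_n -> lsort L)
    (phi : pform (ctx_sum V (fctx s))) :
  exists psi : pform V, forall M (a : tuple_in V M),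
    sat psi a <-> exists d : tuple_in (fctx s) M, sat phi (tuple_sum a d).
Proof.
elim: n s phi => [|n IHn] s phi.
  have [psi psiE] : exists psi : pform V, forall (M : structure L)
      (a : tuple_in V M) (d : tuple_in (fctx s) M),
      sat psi a <-> sat phi (tuple_sum a d).
    have [l lP] := descend phi.
    have [|psi psiE] := lP V (fun M c a => exists d, c = tuple_sum a d).
      by move=> [v|[]//] _; exists (TVar v) => M _ a [d ->].
    by exists psi => M a d; apply: psiE; exists d.
  exists psi => M a; split; last by move=> [d /psiE].
  have d0 : tuple_in (fctx s) M by case.
  by move=> /(psiE _ _ d0) ?; exists d0.
pose W := ctx_ext (ctx_sum V (subctx (W := fctx s) (lift ord0))) (s ord0).
pose A : tuple_rel (ctx_sum V (fctx s)) W := fun M c c' =>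
  exists a (d : tuple_in (fctx s) M), c = tuple_sum a d /\
  c' = tuple_ext (tuple_sum a (subtuple d (lift ord0))) (d ord0).
have [l lP] := descend phi; have [|phi' phiE] := lP W A.
  move=> [v|i] _.
    by exists (@TVar L W (Some (inl v))) => M _ _ [a [d [-> ->]]].
  have [j ->|->] := unliftP ord0 i.
    by exists (@TVar L W (Some (inr j))) => M _ _ [a [d [-> ->]]].
  by exists (@TVar L W None) => M _ _ [a [d [-> ->]]].
have [psi psiE] := IHn _ (PEx phi'); exists psi => M a; rewrite psiE /=.
split=> [[d [x]]|[d dP]]; last first.
  exists (fun i => d (lift ord0 i)), (d ord0); apply/(phiE M (tuple_sum a d))
      => //.
  by exists a, d.
have [|//|d' d'E] := @dep_extend (option 'I_n) 'I_n.+1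
  (fun o => if o is Some i then lift ord0 i else ord0) (fun i => M (s i))
  (fun o => match o return M (s (if o is Some i then lift ord0 i else ord0))
      with
            | Some i => d i | None => x end).
- move=> [i|] [j|] //; first by move=> /lift_inj ->.
- move=> q qP; exfalso; have [j|] := unliftP ord0 q => e.
    exact: (qP (Some j)).
  exact: (qP None).
move=> dxP; exists d'.
suff Aad : A M (tuple_sum a (d' : tuple_in (fctx s) M)) (tuple_ext (tuple_sum a
    d) x).
  by apply/(phiE _ _ _ Aad).
exists a, d'; split=> //.
have -> : d = subtuple (d' : tuple_in (fctx s) M) (lift ord0).
  by apply/functional_extensionality_dep => i; exact: esym (d'E (Some i)).
by have /= <- := d'E None.
Qed.

End Descent.

(** * Ultrapowers and positively closed models *)

Section Ultrapower.
Variables (L : signature) (M : structure L) (J : Type) (U : set_system J).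
Context {UU : UltraFilter U}.

Definition germ (s : lsort L) (f : J -> M s) : set (J -> M s) :=
  [set g | U [set i | f i = g i]].

Definition upow_dom (s : lsort L) : Type :=
  {C : set (J -> M s) | exists f, C = germ f}.

Definition upow_cls (s : lsort L) (f : J -> M s) : upow_dom s :=
  exist _ (germ f) (ex_intro _ f erefl).

Definition upow_rep (s : lsort L) (C : upow_dom s) : J -> M s :=
  sval (cid (svalP C)).

Lemma upow_repK (s : lsort L) (C : upow_dom s) : upow_cls (upow_rep C) = C.
Proof.
rewrite /upow_rep; case: cid => f /= Cf; case: C Cf => C CP /= Cf.
exact: eq_exist (esym Cf).
Qed.

Lemma upow_clsE (s : lsort L) (f g : J -> M s) :
  upow_cls f = upow_cls g <-> U [set i | f i = g i].
Proof.
split=> [fg|Ufg].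
  have : germ f g.
    by rewrite (congr1 sval fg : germ f = germ g); apply: filterS filterT => i.
  exact.
apply: eq_exist; apply/seteqP; split=> h; apply: filterS2 Ufg => i /= -> //.
Qed.

Lemma upow_repE (s : lsort L) (f : J -> M s) :
  U [set i | upow_rep (upow_cls f) i = f i].
Proof. exact/upow_clsE/upow_repK. Qed.

Definition upow : structure L := @Structure L upow_dom
  (fun f a => upow_cls (fun i => fint (fun k => upow_rep (a k) i)))
  (fun r a => U [set i | rint (fun k => upow_rep (a k) i)]).

Lemma upow_rep_all (n : nat) (s : 'I_n -> lsort L)
    (a : forall k, J -> M (s k)) :
  U [set i | (fun k => upow_rep (upow_cls (a k)) i) = fun k => a k i].
Proof.
have : U [set i | forall k, upow_rep (upow_cls (a k)) i = a k i].
  apply: (@filter_forall J 'I_n (fun k i => upow_rep (upow_cls (a k)) i = a k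
      i)).
  by move=> k; apply: upow_repE.
apply: filterS => i ai.
exact/functional_extensionality_dep.
Qed.

Lemma upow_eval (V : ctx (lsort L)) (s : lsort L) (t : term V s)
    (a : forall v : V, J -> M (vsort v)) :
  eval (M := upow) (fun v => upow_cls (a v)) t
    = upow_cls (fun i => eval (fun v => a v i) t).
Proof.
elim: t => [v//|f t IH] /=.
apply/upow_clsE.
apply: filterS (upow_rep_all (fun k i => eval (fun v => a v i) (t k))) => i /=
    <-.
congr fint; apply/functional_extensionality_dep => k; congr (upow_rep _ i).
exact: IH.
Qed.

(** Łoś's theorem for positive formulas: the case of [PBot] rests on the properness of [U], that of
    [POr] on its maximality. *)
Lemma upow_sat (V : ctx (lsort L)) (phi : pform V)
    (a : forall v : V, J -> M (vsort v)) :
  sat (M := upow) phi (fun v => upow_cls (a v))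
    <-> U [set i | sat phi (fun v => a v i)].
Proof.
elim: phi a => {V} [V|V|V s t u|V r t|V phi IH1 psi IH2|V phi IH1 psi IH2|V s
    phi IH] a /=.
- by split=> // _; apply: filterS filterT.
- by split=> // U0; apply: (@filter_not_empty _ U); apply: filterS U0.
- by rewrite !upow_eval upow_clsE.
- have tE i : (fun k => upow_rep (eval (M := upow) (fun v => upow_cls (a v)) (t
    k)) i) =
      fun k => upow_rep (upow_cls (fun i => eval (fun v => a v i) (t k))) i.
    by apply/functional_extensionality_dep => k; rewrite upow_eval.
  under eq_set do rewrite tE.
  have Ut := upow_rep_all (fun k i => eval (fun v => a v i) (t k)).
  by split; apply: filterS2 Ut => i /= ->.
- rewrite IH1 IH2; split=> [[]|H]; first exact: filterS2.
  by split; apply: filterS H => i [].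
- rewrite IH1 IH2; split=> [[]|H].
  + by apply: filterS => i; left.
  + by apply: filterS => i; right.
  have [?|nU] := in_ultra_setVsetC [set i | sat phi (fun v => a v i)] UU.
    by left.
  by right; apply: filterS2 H nU => i [].
- have extE (d : J -> M s) :
      tuple_ext (M := upow) (fun v => upow_cls (a v)) (upow_cls d) =
      fun o => upow_cls (fun i => tuple_ext (fun v => a v i) (d i) o).
    by apply/functional_extensionality_dep; case.
  split=> [[d]|H].
    rewrite -(upow_repK d) extE IH; apply: filterS => i /= di.
    by exists (upow_rep d i).
  (* A sort may be empty, so the default [d0] for the indices without a witness is taken from an
     index that has one; properness of [U] provides it. *)
  have [i0 [d0 _]] : exists i, exists d : M s, sat phi (tuple_ext (fun v => a v
      i) d).
    have [[i iP]|/forallNP nP] := pselect (exists i, exists d : M s,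
        sat phi (tuple_ext (fun v => a v i) d)); first by exists i.
    by case: (@filter_not_empty _ U); apply: filterS H => i /nP.
  have /choice[d dP] : forall i, exists d : M s,
      (exists d : M s, sat phi (tuple_ext (fun v => a v i) d)) ->
      sat phi (tuple_ext (fun v => a v i) d).
    move=> i; have [[d dP]|nd] := pselect (exists d : M s,
        sat phi (tuple_ext (fun v => a v i) d)); first by exists d.
    by exists d0.
  by exists (upow_cls d); rewrite extE IH; apply: filterS H => i /dP.
Qed.

Lemma upow_satisfies (T : set (hsentence L)) :
  satisfies M T -> satisfies upow T.
Proof.
move=> MT h Th a.
have -> : a = fun v => upow_cls (upow_rep (a v)).
  by apply/functional_extensionality_dep => v; rewrite upow_repK.
rewrite !upow_sat; apply: filterS => i; exact: MT.
Qed.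

End Ultrapower.

Section PositivelyClosed.
Variables (L : signature) (T : theory L) (M : structure L).
Hypothesis pcM : pc_model T M.

(** [pc_model] speaks of finite tuples only; [finite_support] reduces to them, with the empty
    context [V0] as the block that it leaves untouched. *)
Lemma pc_reflects (N : structure L) (f : hom M N) : satisfies N T ->
  forall (V : ctx (lsort L)) (phi : pform V) (a : tuple_in V M),
  sat phi (fun v => f _ (a v)) -> sat phi a.
Proof.
move=> NT V phi a fa; pose V0 : ctx (lsort L) := @Ctx _ void (of_void _).
have [phi' phi'E] := subst_form (W := ctx_sum V0 V) phi
  (fun v => @TVar L (ctx_sum V0 V) (inr v)).
have [n [y [psi [_ psiE]]]] := finite_support phi'.
have z (P : structure L) : tuple_in V0 P by case.
have [chi chiE] : exists chi : pform (subctx y), forall P (b : tuple_in V P),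
    sat chi (subtuple b y) <-> sat phi b.
  have [l lP] := descend psi.
  have [|chi chiE] := lP (subctx y) (fun P c d => c = tuple_sum (z P) d).
    by move=> [[]//|i] _; exists (@TVar L (subctx y) i) => P a' b ->.
  exists chi => P b; rewrite (chiE P _ _ erefl) psiE phi'E.
  by rewrite (_ : (fun _ => _) = b).
apply/chiE; apply: (pcM.2 N f NT).
exact: (chiE N (fun v => f _ (a v))).2 fa.
Qed.

(** If [phi] were compatible with every formula of the type of [a], compactness would give a
    homomorphism from [M] to an ultrapower of [M] where the image of [a] satisfies [phi]; since [M]
    is p.c., [a] itself would satisfy [phi]. *)
Lemma pc_contradicts (V : ctx (lsort L)) (phi : pform V) (a : tuple_in V M) :
  ~ sat phi a ->
  exists psi : pform V, sat psi a /\ forall b : tuple_in V M,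
    sat phi b -> ~ sat psi b.
Proof.
move=> nphi; apply: contrapT => /forallNP nopsi.
have {nopsi} cons (psi : pform V) : sat psi a -> exists b : tuple_in V M,
    sat phi b /\ sat psi b.
  move=> psia; apply: contrapT => /forallNP nb; apply: (nopsi psi); split=> //
      b.
  by move=> phib psib; apply: (nb b).
(* [D] names every element of [M], and [J] is the positive diagram of [M] in these names and the
   variables [V], which stand for [a]. *)
pose D : ctx (lsort L) := @Ctx _ (elem M) (fun m => projT1 m).
pose idD : tuple_in D M := fun m => projT2 m.
pose J := {theta : pform (ctx_sum V D) | sat theta (tuple_sum a idD)}.
have /choice[c cP] : forall j : J, exists c : tuple_in (ctx_sum V D) M,
    sat phi (fun v => c (inl v)) /\ sat (sval j) c.
  move=> [theta thetaP] /=.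
  (* Quantifying out the finitely many names in [theta] gives a formula true of [a], hence by [cons]
     true of some [b] satisfying [phi]; the remaining names denote themselves. *)
  have [n [y [psi [yI psiE]]]] := finite_support theta.
  have [chi chiE] := exists_block psi.
  have [|b [phib]] := cons chi.
    by apply/chiE; exists (subtuple idD y); apply/psiE.
  move=> /chiE[d]; have [|e eE] := dep_extend (y := y)
    (F := fun m : D => M (vsort m)) d yI.
    by move=> q _; exists; exact: idD.
  have -> : d = subtuple (e : tuple_in D M) y.
    by apply/functional_extensionality_dep => i; exact: esym (eE i).
  by move=> /psiE be; exists (tuple_sum b (e : tuple_in D M)).
(* Conjunctions of diagram formulas give closure under intersection, and the index [theta] satisfies
   [theta], so no set of [F] is empty. *)
pose F : set_system J := [set A | exists theta : J,
  [set j | sat (sval theta) (c j)] `<=` A].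
have FF : ProperFilter F.
  split; last split.
  - by move=> [theta /(_ theta)]; apply; exact: (cP theta).2.
  - by exists (exist _ (@PTop L _) I).
  - move=> A B [[t tP] tA] [[u uP] uB].
    by exists (exist _ (PAnd t u) (conj tP uP)) => j /= [/tA ? /uB ?].
  - by move=> A B AB [t tA]; exists t; apply: subset_trans AB.
have [U [UU FU]] := ultraFilterLemma FF.
have Utrue (theta : pform (ctx_sum V D)) :
    sat theta (tuple_sum a idD) -> U [set j | sat theta (c j)].
  by move=> thetaP; apply: FU; exists (exist _ theta thetaP).
pose h (s : lsort L) (m : M s) : upow M U s :=
  upow_cls U (fun j => c j (inr (existT _ s m : D)) : M s).
pose tv (s : lsort L) (m : M s) : term (ctx_sum V D) s :=
  @TVar L (ctx_sum V D) (inr (existT _ s m)).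
have h_fint (f : lfunc L) (m : forall i : 'I_(far f), M (fsort i)) :
    h _ (fint m) = fint (fun i => h _ (m i)).
  apply/upow_clsE.
  have := Utrue (PEq (tv _ (fint m)) (TFun (fun i => tv _ (m i)))) erefl.
  apply: filterS2 (upow_rep_all (fun i j => c j (inr (existT _ (fsort i) (m i)
      : D)) : M _)).
  by move=> j /= -> ->.
have h_rint (r : lrel L) (m : forall i : 'I_(rar r), M (rsort i)) :
    rint m -> rint (s := upow M U) (fun i => h _ (m i)).
  move=> rm; have := Utrue (PRel (fun i => tv _ (m i))) rm.
  apply: filterS2 (upow_rep_all (fun i j => c j (inr (existT _ (rsort i) (m i)
      : D)) : M _)).
  by move=> j /= -> .
apply: nphi; apply: (@pc_reflects _ (Hom h_fint h_rint)).
  exact/upow_satisfies/pcM.1.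
(* The equation between [v] and the name of [a v] lies in the diagram, so [a] is sent to the class
   of tuples that all satisfy [phi]. *)
have -> : (fun v : V => h _ (a v)) =
    fun v : V => upow_cls U (fun j => c j (inl v) : M (vsort v)).
  apply/functional_extensionality_dep => v; apply/upow_clsE.
  exact: (Utrue (PEq (tv _ (a v)) (@TVar L (ctx_sum V D) (inl v)))).
by apply/upow_sat; apply: filterS filterT => j _; exact: (cP j).1.
Qed.

End PositivelyClosed.

(** * Well-orders and binary trees *)

Section WellOrder.
Variables (J : eqType) (lt : rel J).

Definition strict_well_order := [/\ irreflexive lt, transitive lt &
  forall S : set J, S !=set0 -> exists2 x, S x & forall y, S y -> y != x -> lt
      x y].

Hypothesis ltW : strict_well_order.

Lemma swo_total x y : x != y -> lt x y || lt y x.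
Proof.
move=> xy; have [_ _ /(_ [set x; y])[|z [->|->]]] := ltW; first by exists x;
    left.
  by move=> /(_ y (or_intror erefl)) ->//; rewrite eq_sym.
by move=> /(_ x (or_introl erefl)) ->//; rewrite orbT.
Qed.

Lemma swo_enum (s : seq J) :
  exists2 t, pairwise lt t & {subset s <= t}.
Proof.
have [_ ltT _] := ltW.
elim: s => [|x s [t tlt st]]; first by exists [::].
exists ([seq y <- t | lt y x] ++ x :: [seq y <- t | lt x y]).
  rewrite pairwise_cat /= !pairwise_filter// filter_all/= andbT.
  apply/allrelP => y z; rewrite mem_filter in_cons mem_filter => /andP[yx _].
  by move=> /predU1P[->//|/andP[xz _]]; exact: ltT xz.
move=> y; rewrite in_cons mem_cat in_cons !mem_filter.
have [//|xy /= /st ->] := eqVneq y x; first by rewrite orbT.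
by rewrite !andbT; exact: swo_total.
Qed.

End WellOrder.

(* [J] is the longest initial segment of a well-ordering of [A] all of whose
   proper initial segments have at most [|A|] subsets. *)
Lemma branching_order (A : Type) : exists (J : eqType) (lt : rel J),
  [/\ strict_well_order lt, embeds J A,
      forall x, embeds (set {y | lt y x}) A & ~ embeds (set J) A].
Proof.
have [R Rwo] := well_ordering_principle {classic A}.
have Rmin (S : set {classic A}) : S !=set0 ->
    exists2 x, S x & forall y, S y -> R x y.
  move=> [x Sx]; have [|z [[zS zmin] _]] := Rwo [pred y | `[< S y >]].
    by exists x; apply/asboolP.
  exists z; first exact/asboolP.
  by move=> y Sy; apply: zmin; apply/asboolP.
have Rxx x : R x x by have [|y ->] := Rmin [set x]; [exists x|apply].
have Ranti x y : R x y -> R y x -> x = y.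
  move=> xy yx; have [|z [_ zU]] := Rwo (pred2 x y).
    by exists x; rewrite !inE eqxx.
  rewrite -(zU x) ?(zU y)//; split; rewrite ?inE ?eqxx ?orbT// => u;
    by rewrite !inE => /orP[] /eqP ->.
have Rneg x y : ~~ R x y -> R y x.
  move=> nxy; have [|z [->|->]] := Rmin [set x; y]; first by exists x; left.
    by move=> /(_ y (or_intror erefl)); rewrite (negbTE nxy).
  by apply; left.
have Rtr x y z : R x y -> R y z -> R x z.
  move=> xy yz; have [|w [[->|->]|->]] := Rmin [set x; y; z].
  - by exists x; left; left.
  - by apply; right.
  - by move=> yP; rewrite (Ranti x y)//; apply: yP; left; left.
  - by move=> zP; rewrite -(Ranti y z) //; apply: zP; left; right.
pose seg x := {y | ~~ R x y}.
pose J : eqType := {classic {x : {classic A} | embeds (set (seg x)) A}}.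
pose lt : rel J := fun x y => ~~ R (sval y) (sval x).
exists J, lt; split.
- split.
  + by move=> x; rewrite /lt Rxx.
  + move=> y x z; rewrite /lt => xy yz; apply: contra xy => zx.
    exact: Rtr (Rneg _ _ yz) zx.
  + move=> S [x Sx]; have [|z [y Sy <-] ymin] := Rmin [set sval x | x in S].
      by exists (sval x), x.
    exists y => // u Su uy; apply/negP => Ruy; move/eqP: uy; apply.
    have /Ranti /(_ Ruy) : R (sval y) (sval u) by apply: ymin; exists u.
    by case: (y) (u) => ? ? [? ?] /= ?; apply: eq_exist.
- exact: embeds_sig.
- move=> x; apply: embeds_trans (svalP x); apply: embeds_set.
  exists (fun y : {y | lt y x} =>
    exist (fun z => ~~ R (sval x) z) (sval (sval y)) (svalP y)) => -[y yx] [z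
        zx] [].
  by move=> yz; apply/eq_exist; case: (y) (z) yz => ? ? [? ?] /= ?; apply:
      eq_exist.
(* If every point qualified, [set A] would embed in [A]. Otherwise the segment below the least point
   left out lies in [J], and [JA] would bound its subsets. *)
move=> JA; have [[x xJ]|/forallNP allJ] :=
    pselect (exists x, ~ embeds (set (seg x)) A); last first.
  apply: (@not_embeds_set A); apply: embeds_trans JA; apply: embeds_set.
  exists (fun x => exist _ x (contrapT (allJ x))) => x y.
  by move=> /(congr1 sval).
have [|y yJ ymin] := Rmin [set x | ~ embeds (set (seg x)) A]; first by exists x.
apply: yJ; apply: embeds_trans JA; apply: embeds_set.
have segJ z : seg y -> embeds (set (seg z)) A \/ R y z.
  by move=> _; have [?|/ymin] := pselect (embeds (set (seg z)) A); [left|right].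
have /choice[f fP] : forall z : seg y, exists j : J, sval j = sval z.
  move=> [z yz]; have [zA|/ymin] := pselect (embeds (set (seg z)) A).
    by exists (exist _ z zA).
  by rewrite (negbTE yz).
exists f => z z' e; have := fP z; rewrite e fP.
by case: (z) (z') => ? ? [? ?] /= ?; apply: eq_exist.
Qed.

Section Splitting.
Variables (A B : Type) (P Q : B -> set A).

(** This says that the local two-rank of [D] for the pair [P], [Q] is at least [n]; [b] is the
    parameter at the root of the tree. *)
Fixpoint splits (n : nat) (D : set A) : Prop :=
  if n is n'.+1 then exists b, splits n' (D `&` P b) /\ splits n' (D `&` Q b)
  else D !=set0.

Lemma splits_sub n (D D' : set A) : D `<=` D' -> splits n D -> splits n D'.
Proof.
elim: n D D' => [|n IH] D D' DD' /=; first by move=> [x /DD']; exists x.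
by move=> [b [DP DQ]]; exists b; split;
  [apply: IH DP|apply: IH DQ] => x [/DD'].
Qed.

Variables (J : eqType) (lt : rel J).

(** A node is a level with the turns taken strictly below it, so branches that agree below a level
    share their node there. *)
Definition node : Type := {x : J & set {y | lt y x}}.

Definition below (k : node) : set {y | lt y (projT1 k)} := projT2 k.

Arguments below k _ : clear implicits.

Definition node_of (h : set J) (x : J) : node :=
  existT _ x (fun y => h (sval y)).

(** A finite tree is spread over the levels in [s], its root at the lowest. As [s] increases, a node
    at a later level records the turn taken at the root, which selects the subtree that provides its
    parameter. *)
Lemma splits_tree (b0 : B) (s : seq J) (D : set A) :
  irreflexive lt -> pairwise lt s -> splits (size s) D ->
  exists (b : node -> B) (a : set J -> A), forall h, D (a h) /\
    forall x, x \in s ->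
      (h x -> P (b (node_of h x)) (a h)) /\
      (~ h x -> Q (b (node_of h x)) (a h)).
Proof.
move=> ltI; elim: s D => [|x s IHs] D /=.
  by move=> _ [a Da]; exists (fun=> b0), (fun=> a).
move=> /andP[xs slt] [c [/(IHs _ slt)[b [a abP]] /(IHs _ slt)[b' [a' abQ]]]].
exists (fun k => if projT1 k == x then c else
  if `[< exists2 y, below k y & sval y = x >] then b k else b' k).
exists (fun h => if `[< h x >] then a h else a' h) => h.
have nodeP y : y \in s -> `[< exists2 z, below (node_of h y) z & sval z = x >]
    = `[< h x >].
  move=> ys; apply/asbool_equiv_eq; split; first by move=> [z hz <-].
  by move=> hx; exists (exist _ x (allP xs y ys)).
have neq y : y \in s -> y == x = false.
  by move=> /(allP xs); apply: contraTF => /eqP ->; rewrite ltI.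
have [[aD aP] [a'D a'P]] := (abP h, abQ h).
case: asboolP nodeP => hx nodeP; split; [exact: aD.1| |exact: a'D.1|];
  move=> y; rewrite in_cons => /predU1P[->|ys] /=.
- by rewrite eqxx; split=> // _; exact: aD.2.
- by rewrite neq// nodeP//; exact: aP.
- by rewrite eqxx; split=> // _; exact: a'D.2.
- by rewrite neq// nodeP//; exact: a'P.
Qed.

Lemma embeds_node (C : Type) : embeds J C ->
  (forall x, embeds (set {y | lt y x}) C) -> embeds node (C * C).
Proof.
move=> [e eI] /dchoice[g gI].
exists (fun k => (e (projT1 k), g _ (projT2 k))).
by move=> [x f] [y f'] /= [/eI xy]; subst y => /gI ->.
Qed.

End Splitting.

(** * Finiteness of the local two-rank in a stable structure *)

Lemma finite_range_sub (A B : Type) (f : A -> B) (F : set B) :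
  finite_set F -> F `<=` range f -> exists s : seq A,
  forall y, F y -> exists2 x, List.In x s & f x = y.
Proof.
move=> /(@finite_seqP {classic B})[t tF] Ff.
have : forall y : {classic B}, y \in t -> range f y.
  by move=> y yt; apply: Ff; rewrite tF.
rewrite tF {F tF Ff}; elim: t => [|y t IHt] tf; first by exists [::].
have [x _ xy] := tf y (mem_head _ _).
have [|s sP] := IHt; first by move=> z zt; apply: tf; rewrite in_cons zt orbT.
exists (x :: s) => z /=; rewrite in_cons => /predU1P[->|/sP[u us uz]].
  by exists x => //; left.
by exists u => //; right.
Qed.

Section Stability.
Variables (L : signature) (K : Type) (M : structure L).
Hypothesis hK : strong_limit K.
Hypothesis satM : saturated K M.

Definition fiber (X Y : ctx (lsort L)) (phi : pform (ctx_sum X Y))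
    (b : tuple_in Y M) : set (tuple_in X M) :=
  [set a | sat phi (tuple_sum a b)].

Definition contradictory (V : ctx (lsort L)) (phi psi : pform V) :=
  forall c : tuple_in V M, sat phi c -> ~ sat psi c.

(* If every finite binary tree of instances of [phi] and [psi] were consistent,
   saturation would provide such a tree of height [J]; its nodes form at most
   [lam] parameters, but its branches have more than [lam] types over them. *)
Lemma stable_not_splits (lam : Type) : infinite_set [set: lam] ->
  small K lam -> card_stable lam M ->
  forall (X : ctx (lsort L)) (m : nat) (s : 'I_m -> lsort L)
    (phi psi : pform (ctx_sum X (fctx s))),
  small K X -> contradictory phi psi ->
  exists n, ~ splits (fiber phi) (fiber psi) n setT.
Proof.
move=> /infiniteP/embedsP lamN Klam stM X m s phi psi KX con.
apply: contrapT => /forallNP nsplit.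
have {nsplit}sp n : splits (fiber phi) (fiber psi) n setT.
  exact: contrapT (nsplit n).
have [Kn Kset] := hK.
have [J [lt [ltW Jlam seglam nJ]]] := branching_order lam.
have [ltI ltT ltmin] := ltW.
have lam2 := embeds_square lamN.
have nodelam : embeds (node lt) lam.
  exact: embeds_trans (embeds_node Jlam seglam) lam2.
(* One parameter tuple for each node and a copy of [X] for each branch; there are few enough
   branches because [K] is a strong limit. *)
pose Zv : Type := (node lt * 'I_m + set J * X)%type.
pose Z : ctx (lsort L) := @Ctx _ Zv (fun z => match z with
  | inl p => s p.2 | inr p => vsort p.2 end).
have ordN k : embeds 'I_k nat by exists (@nat_of_ord k); exact: val_inj.
have nodesmall : embeds (node lt * 'I_m) lam.
  by apply: embeds_trans lam2; apply: embeds_prod => //; apply: embeds_trans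
      lamN.
have KZ : small K Z.
  apply: small_sum => //; first exact: small_embeds nodesmall _.
  by apply: small_prod => //; apply/(small_embeds (embeds_set Jlam))/Kset.
pose B0 : set (elem M) := set0.
have KB0 : small K (set_type B0).
  by apply: small_embeds Kn; exists (fun=> 0) => -[x xB]; case: (set_mem xB).
pose branch (a : tuple_in Z M) (h : set J) : tuple_in X M :=
  fun v => a (inr (h, v)).
pose param (a : tuple_in Z M) (k : node lt) : tuple_in (fctx s) M :=
  fun i => a (inl (k, i)).
have inst (chi : pform (ctx_sum X (fctx s))) h x :
    exists theta : pform (ctx_sum Z (param_ctx B0)), forall a : tuple_in Z M,
    sat_over a theta <-> fiber chi (param a (node_of lt h x)) (branch a h).
  have [theta thetaE] := subst_sum (W := ctx_sum Z (param_ctx B0)) chi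
    (fun v => @TVar L (ctx_sum Z (param_ctx B0)) (inl (inr (h, v))))
    (fun i => @TVar L (ctx_sum Z (param_ctx B0)) (inl (inl (node_of lt h x,
        i)))).
  by exists theta => a; rewrite /sat_over thetaE.
have /choice[fm fmE] : forall p : set J * J,
    exists theta : pform (ctx_sum Z (param_ctx B0)), forall a : tuple_in Z M,
    sat_over a theta <->
    (p.1 p.2 -> fiber phi (param a (node_of lt p.1 p.2)) (branch a p.1)) /\
    (~ p.1 p.2 -> fiber psi (param a (node_of lt p.1 p.2)) (branch a p.1)).
  move=> [h x] /=; have [hx|nhx] := pselect (h x).
    by have [theta thetaE] := inst phi h x; exists theta => a; rewrite thetaE;
      split=> [?|[/(_ hx)]].
  by have [theta thetaE] := inst psi h x; exists theta => a; rewrite thetaE;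
    split=> [?|[_ /(_ nhx)]].
have [|a aP] := satM KZ KB0 (Sigma := range fm).
  (* Finitely many conditions concern finitely many levels, over which a finite tree can be
     spread. *)
  move=> F Ffin /(finite_range_sub Ffin)[l lP].
  have [t tlt lt_sub] := swo_enum ltW [seq p.2 | p <- l].
  (* The sorts in [s] might be empty a priori; the root of a tree of height one supplies the default
     parameter. *)
  have [b0 _] := sp 1.
  have [b [c bcP]] := splits_tree b0 ltI tlt (sp _).
  exists (fun z : Zv => match z return M (vsort (c := Z) z) with
    | inl p => b p.1 p.2 | inr p => c p.1 p.2 end) => theta /lP[[h x] hxl <-].
  apply/fmE; apply: (bcP h).2; apply: lt_sub.
  elim: l hxl {lP} => [//|q l IHl] /= [->|/IHl]; rewrite in_cons ?eqxx//.
  by move=> ->; rewrite orbT.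
have {aP fmE}aP h x :
    (h x -> fiber phi (param a (node_of lt h x)) (branch a h)) /\
    (~ h x -> fiber psi (param a (node_of lt h x)) (branch a h)).
  by apply/(fmE (h, x) a); apply: aP; exists (h, x).
(* [X] may be infinite, whereas [card_stable] counts types of finite tuples. Swapping the blocks
   lets [finite_support] cut [X] down to variables that determine [phi]. *)
have [phis phisE] : exists phis : pform (ctx_sum (fctx s) X),
    forall (b : tuple_in (fctx s) M) (c : tuple_in X M),
    sat phis (tuple_sum b c) <-> fiber phi b c.
  have [phis phisE] := subst_sum phi (W := ctx_sum (fctx s) X)
    (fun v => @TVar L (ctx_sum (fctx s) X) (inr v))
    (fun i => @TVar L (ctx_sum (fctx s) X) (inl i)).
  by exists phis => b c; rewrite phisE.
have [n [x [phi' [_ phi'E]]]] := finite_support phis.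
pose pe (p : node lt * 'I_m) : elem M := existT _ (s p.2) (param a p.1 p.2).
pose B : set (elem M) := range pe.
have Blam : B #<= [set: lam].
  by apply: card_le_trans (card_image_le _ _) _; apply/embedsP.
have /card_le_embeds := stM B Blam n (fun i => vsort (x i)).
move=> tplam; apply: nJ; apply: embeds_trans tplam.
pose type h := tp B (subtuple (branch a h) x).
exists (fun h => exist (fun t => t \in range (tp B (X := subctx x))) (type h)
  (mem_set (imageT _ _))) => h h' /(congr1 sval) /= hh'.
(* Branches that agree below [z] share the node there; if their types agree, [phi] passes from one
   to the other and excludes [psi]. *)
have sub g g' : type g = type g' -> forall z,
    (forall y, lt y z -> g y <-> g' y) -> g z -> g' z.
  move=> gg' z gz hz; apply: contrapT => nhz.
  have e : node_of lt g z = node_of lt g' z.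
    congr existT; apply/funext => -[y yz] /=; exact/propext/gz.
  pose q (i : 'I_m) : param_ctx B := SigSub (mem_set (imageT pe (node_of lt g
      z, i))).
  have [phi2 phi2E] := subst_sum phi' (W := ctx_sum (subctx x) (param_ctx B))
    (fun i => @TVar L (ctx_sum (subctx x) (param_ctx B)) (inr (q i)))
    (fun i => @TVar L (ctx_sum (subctx x) (param_ctx B)) (inl i)).
  have phi2P k : type k phi2 <-> fiber phi (param a (node_of lt g z)) (branch a
      k).
    by rewrite /type/tp /= /sat_over phi2E -phisE -phi'E.
  have : type g phi2 by apply/phi2P; exact: (aP g z).1.
  rewrite gg' => /phi2P; rewrite e => /con; apply; exact: (aP g' z).2.
apply: contrapT => nhh.
have [|z zne zmin] := ltmin [set z | ~ (h z <-> h' z)].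
  apply: contrapT => /set0P/negP/negPn/eqP nz; apply: nhh; apply/funext => z.
  by apply/propext; apply: contrapT => zP; have : set0 z by rewrite -nz.
have lez y : lt y z -> h y <-> h' y.
  move=> yz; apply: contrapT => /zmin zy.
  have : lt z y by apply: zy; apply: contraTneq yz => ->; rewrite ltI.
  by move=> /(ltT _ _ _ yz); rewrite ltI.
by apply: zne; split; apply: sub => // y /lez[].
Qed.

End Stability.

(** * Counting formulas and types *)

Lemma existT_inj (A : Type) (P : A -> Type) (x : A) (a b : P x) :
  existT P x a = existT P x b -> a = b.
Proof.
move=> e; have := projT2_eq e.
by rewrite (Prop_irrelevance (projT1_eq e) erefl).
Qed.

Section Encoding.
Variables (L : signature) (W : Type).
Variables (pr : W * W -> W) (c : nat -> W).
Variables (cS : lsort L -> W) (cF : lfunc L -> W) (cR : lrel L -> W).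
Hypotheses (prI : injective pr) (cI : injective c).
Hypotheses (cSI : injective cS) (cFI : injective cF) (cRI : injective cR).

(** The length is not coded: in each use it is fixed by a symbol or a number that is coded beside
    it. *)
Definition enc_fun (n : nat) (g : 'I_n -> W) : W :=
  foldr (fun i w => pr (g i, w)) (c 0) (enum 'I_n).

Lemma enc_fun_inj (n : nat) : injective (@enc_fun n).
Proof.
move=> g h gh; apply/funext => i; move: gh (mem_enum 'I_n i); rewrite /enc_fun.
elim: (enum _) => [//|j s IHs] /= /prI[gj /IHs{}IHs].
by rewrite in_cons => /predU1P[->|/IHs].
Qed.

Fixpoint enc_term (V : ctx (lsort L)) (cV : V -> W) (s : lsort L)
    (t : term V s) : W :=
  match t with
  | TVar v => pr (c 0, cV v)
  | TFun f t => pr (c 1, pr (cF f, enc_fun (fun i => enc_term cV (t i))))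
  end.

(** Equal codes are not known beforehand to come from equal sorts, so terms are compared as
    dependent pairs. *)
Lemma enc_term_inj (V : ctx (lsort L)) (cV : V -> W) : injective cV ->
  forall (s s' : lsort L) (t : term V s) (t' : term V s'),
  enc_term cV t = enc_term cV t' -> existT _ s t = existT _ s' t'.
Proof.
move=> cVI s s' t; elim: t s' => [v|f t IH] s' [v'|f' t'] /=.
- by move=> /prI[/cVI ->].
- by move=> /prI[/cI].
- by move=> /prI[/cI].
move=> /prI[/prI[/cFI ff']]; subst f' => /enc_fun_inj tt'.
congr (existT _ _ (TFun _)); apply/functional_extensionality_dep => i.
exact/existT_inj/IH/(congr1 (@^~ i) tt').
Qed.

Definition enc_ext (V : Type) (cV : V -> W) (o : option V) : W :=
  if o is Some v then pr (c 1, cV v) else pr (c 0, c 0).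

Lemma enc_ext_inj (V : Type) (cV : V -> W) :
  injective cV -> injective (enc_ext cV).
Proof.
move=> cVI [v|] [v'|] //= /prI[].
- by move=> /cVI ->.
- by move=> /cI.
- by move=> /cI.
Qed.

Fixpoint enc_form (V : ctx (lsort L)) (cV : V -> W) (phi : pform V) : W :=
  match phi with
  | PTop => pr (c 0, c 0)
  | PBot => pr (c 1, c 0)
  | PEq s t u => pr (c 2, pr (enc_term cV t, enc_term cV u))
  | PRel r t => pr (c 3, pr (cR r, enc_fun (fun i => enc_term cV (t i))))
  | PAnd phi psi => pr (c 4, pr (enc_form cV phi, enc_form cV psi))
  | POr phi psi => pr (c 5, pr (enc_form cV phi, enc_form cV psi))
  | PEx s phi =>
      pr (c 6, pr (cS s, enc_form (V := ctx_ext V s) (enc_ext cV) phi))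
  end.

Lemma enc_form_inj (V : ctx (lsort L)) (cV : V -> W) :
  injective cV -> injective (@enc_form V cV).
Proof.
move=> cVI phi; elim: phi cV cVI => {V} [V|V|V s t u|V r t|V phi IH1 psi IH2|V
    phi IH1 psi IH2|V s phi IH] cV cVI
  [||s' t' u'|r' t'|phi' psi'|phi' psi'|s' phi'] //=;
  try by move=> /prI[/cI].
- move=> /prI[/prI[/(enc_term_inj cVI) tt' /(enc_term_inj cVI) uu']].
  have ss' := projT1_eq tt'; simpl in ss'; subst s'.
  by rewrite (existT_inj tt') (existT_inj uu').
- move=> /prI[/prI[/cRI rr']]; subst r' => /enc_fun_inj tt'.
  congr PRel; apply/functional_extensionality_dep => i.
  exact/existT_inj/(enc_term_inj cVI)/(congr1 (@^~ i) tt').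
- by move=> /prI[/prI[/(IH1 _ cVI) -> /(IH2 _ cVI) ->]].
- by move=> /prI[/prI[/(IH1 _ cVI) -> /(IH2 _ cVI) ->]].
- by move=> /prI[/prI[/cSI ss']]; subst s' => /(IH _ (enc_ext_inj cVI)) ->.
Qed.

End Encoding.

Section Cardinality.
Variables (L : signature) (W : Type).
Hypotheses (natW : embeds nat W) (LW : embeds (lsort L + lfunc L + lrel L) W).

Lemma embeds_pform (V : ctx (lsort L)) : embeds V W -> embeds (pform V) W.
Proof.
move=> [cV cVI]; have [pr prI] := embeds_square natW.
have [[c cI] [cL cLI]] := (natW, LW).
exists (enc_form pr c (cL \o inl \o inl) (cL \o inl \o inr) (cL \o inr) cV).
by apply: enc_form_inj => // x y /= /cLI [].
Qed.

(** A finite block of variables replaces the parameters, so the number of templates is bounded in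
    terms of [X] and the language, whatever the parameter set. *)
Definition template (X : ctx (lsort L)) : Type :=
  {m : nat & {s : 'I_m -> lsort L &
    (pform (ctx_sum X (fctx s)) * pform (ctx_sum X (fctx s)))%type}}.

Lemma embeds_template (X : ctx (lsort L)) : embeds X W -> embeds (template X) W.
Proof.
move=> XW; have W2 := embeds_square natW.
apply: (@embeds_trans (W * (W * (W * W)))); last first.
  apply: embeds_trans (W2); apply: embeds_prod; first exact: embeds_refl.
  apply: embeds_trans (W2); apply: embeds_prod => //; exact: embeds_refl.
have [pr prI] := W2; have [[c cI] [cL cLI]] := (natW, LW).
have /dchoice[e eI] : forall p : {m : nat & 'I_m -> lsort L},
    exists e : pform (ctx_sum X (fctx (projT2 p))) -> W, injective e.
  move=> [m s] /=; apply: embeds_pform => /=.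
  apply: embeds_trans (embeds_double natW); apply: embeds_sum => //.
  by apply: embeds_trans natW; exists (@nat_of_ord m); exact: val_inj.
exists (fun q => let p := existT _ (projT1 q) (projT1 (projT2 q)) in
  (c (projT1 q), (enc_fun pr c (cL \o inl \o inl \o projT1 (projT2 q)),
   (e p (projT2 (projT2 q)).1, e p (projT2 (projT2 q)).2)))).
move=> [m [s [phi psi]]] [m' [s' [phi' psi']]] /= [/cI mm']; subst m'.
move=> /(enc_fun_inj prI) ss'.
have {}ss' : s = s'.
  by apply/funext => i; have /cLI[] := congr1 (@^~ i) ss'.
by subst s' => /eI -> /eI ->.
Qed.

End Cardinality.

(* The type of [a] over [p] is determined by the choice, for each template
   [(phi, psi)], of a formula of the type whose [splits]-rank with respect to
   [(phi, psi)] is minimal. *)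
Lemma stable_few_types (L : signature) (K : Type) (T : theory L)
    (M : structure L) (W lam : Type) :
  strong_limit K -> pc_model T M -> saturated K M ->
  infinite_set [set: lam] -> small K lam -> card_stable lam M ->
  embeds nat W -> embeds (lsort L + lfunc L + lrel L) W ->
  forall X P : ctx (lsort L), small K X -> embeds X W -> embeds P (set W) ->
  forall p : tuple_in P M, exists (Y : Type) (code : tuple_in X M -> Y),
  embeds Y (set W) /\ forall a a', code a = code a' ->
  forall theta : pform (ctx_sum X P),
  sat theta (tuple_sum a p) -> sat theta (tuple_sum a' p).
Proof.
move=> hK pcM satM lamI Klam stM natW LW X P KX XW PW p.
have natSW : embeds nat (set W) by exact: embeds_trans (embeds_set1 W).
(* For a contradictory pair, [n] is the least height at which some formula of the type of [a] fails
   to split, and [theta] is such a formula. *)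
pose full (q : template X) a theta := sat theta (tuple_sum a p) /\
  let phi := (projT2 (projT2 q)).1 in let psi := (projT2 (projT2 q)).2 in
  (contradictory M phi psi -> exists n,
   ~ splits (fiber (M := M) phi) (fiber psi) n (fiber theta p) /\
   forall theta', sat theta' (tuple_sum a p) -> forall k, k < n ->
   splits (fiber phi) (fiber psi) k (fiber theta' p)).
have /choice[code codeP] : forall a, exists code : template X -> pform (ctx_sum
    X P),
    forall q, full q a (code q).
  move=> a; suff /choice[f fP] : forall q, exists theta, full q a theta by
      exists f.
  move=> [m [s [phi psi]]]; rewrite /full /=.
  have [con|nc] := pselect (contradictory M phi psi); last first.
    by exists (@PTop L _); split.
  pose bad n := exists2 theta, sat theta (tuple_sum a p) &
    ~ splits (fiber phi) (fiber psi) n (fiber theta p).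
  have exbad : exists n, `[< bad n >].
    have [n nP] := stable_not_splits hK satM lamI Klam stM KX con.
    exists n; apply/asboolP; exists (@PTop L _) => //.
  have [n /asboolP[theta thetaP nsp] nmin] := ex_minnP exbad.
  exists theta; split => // _; exists n; split=> // theta' theta'P k kn.
  apply: contrapT => nk; have : n <= k.
    by apply: nmin; apply/asboolP; exists theta'.
  by rewrite leqNgt kn.
exists (template X -> pform (ctx_sum X P)), code; split.
  (* Formulas over [P] embed in [set W] and templates in [W]; a function from templates to [set W]
     amounts to a set of pairs. *)
  apply: (@embeds_trans (template X -> set W)).
    have [e eI] : embeds (pform (ctx_sum X P)) (set W).
      apply: embeds_pform => //.
        exact: embeds_trans (embeds_set1 W).
      apply: embeds_trans (embeds_double natSW); apply: embeds_sum => //.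
      exact: embeds_trans (embeds_set1 W).
    exists (fun f q => e (f q)) => f g fg; apply/funext => q.
    exact/eI/(congr1 (@^~ q) fg).
  apply: embeds_trans (embeds_fun_set _ _) _; apply: embeds_set.
  apply: embeds_trans (embeds_square natW); apply: embeds_prod.
    exact: embeds_template.
  exact: embeds_refl.
move=> a a' aa' theta thetaa; apply: contrapT => nthetaa'.
have [m [y [phi [_ phiE]]]] := finite_support theta.
have [psi [psia' con]] : exists psi, sat psi (tuple_sum a' (subtuple p y)) /\
    contradictory M phi psi.
  by apply: (pc_contradicts pcM); rewrite phiE.
pose q : template X := existT _ m (existT _ (fun i => vsort (y i)) (phi, psi)).
have [Ca [n [nsp nP]]] : sat (code a q) (tuple_sum a p) /\ exists n,
   ~ splits (fiber phi) (fiber psi) n (fiber (code a q) p) /\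
   forall theta', sat theta' (tuple_sum a p) -> forall k, k < n ->
   splits (fiber phi) (fiber psi) k (fiber theta' p).
  by have [? /(_ con)] := codeP a q.
have [Ca' [n' [nsp' nP']]] : sat (code a q) (tuple_sum a' p) /\ exists n,
   ~ splits (fiber phi) (fiber psi) n (fiber (code a q) p) /\
   forall theta', sat theta' (tuple_sum a' p) -> forall k, k < n ->
   splits (fiber phi) (fiber psi) k (fiber theta' p).
  by rewrite aa'; have [? /(_ con)] := codeP a' q.
(* The chosen formula lies in both types, so neither minimal height exceeds the other. *)
have nn' : n = n'.
  apply/eqP; rewrite eqn_leq; apply/andP; split; rewrite leqNgt; apply/negP.
    by move=> /(nP _ Ca).
  by move=> /(nP' _ Ca').
subst n'; case: n => [|n] in nsp nP nsp' nP' *; first by apply: nsp; exists a.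
have [psiP psiPE] := subst_sum psi
  (fun v => @TVar L (ctx_sum X P) (inl v)) (fun i => @TVar L (ctx_sum X P) (inr
      (y i))).
(* Conjoined with [theta], the common formula stays in the type of [a]; conjoined with [psiP], in
   that of [a']. By minimality both conjunctions split to height [n], so the common formula splits
   to height [n.+1]. *)
apply: nsp; exists (subtuple p y); split.
- apply: splits_sub (nP (PAnd (code a q) theta) _ n (ltnSn n)) => //.
  by move=> c [? ?]; split=> //; apply/phiE.
- apply: splits_sub (nP' (PAnd (code a q) psiP) _ n (ltnSn n)).
    by move=> c [? /psiPE].
  by split=> //; apply/psiPE.
Qed.

(** * Hyperimaginaries *)

Lemma hom_eval (L : signature) (M N : structure L) (f : hom M N)
    (V : ctx (lsort L)) (a : tuple_in V M) (s : lsort L) (t : term V s) :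
  eval (fun v => f _ (a v)) t = f _ (eval a t).
Proof.
elim: t => [v//|g t IH] /=; rewrite hom_fint; congr fint.
exact/functional_extensionality_dep.
Qed.

Lemma hom_sat (L : signature) (M N : structure L) (f : hom M N)
    (V : ctx (lsort L)) (phi : pform V) (a : tuple_in V M) :
  sat phi a -> sat phi (fun v => f _ (a v)).
Proof.
elim: phi a => {V} [V|V|V s t u|V r t|V phi IH1 psi IH2|V phi IH1 psi IH2|V s
    phi IH] a //=.
- by rewrite !hom_eval => ->.
- move=> /(hom_rint f).
  have -> // : (fun i => f _ (eval a (t i))) =
    (fun i => eval (fun v => f _ (a v)) (t i)).
  by apply/functional_extensionality_dep => i; rewrite hom_eval.
- by move=> [/IH1 ? /IH2].
- by move=> [/IH1|/IH2]; [left|right].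
- move=> [d /IH dP]; exists (f _ d).
  have -> // : tuple_ext (fun v => f _ (a v)) (f _ d) =
    (fun v => f _ (tuple_ext a d v)).
  by apply/functional_extensionality_dep; case.
Qed.

Section Hyperimaginaries.
Variables (L : signature) (M : structure L) (I : Type) (E : I -> tdrel L).
Hypothesis hE : forall i : I, Equivalence (@tdint L M (E i)).

Lemma represents_exists (z : hyp_sort L I) (c : hyp_dom E M z) :
  exists a : tuple_in (hyp_block E z) M, represents a c.
Proof.
case: z c => [s m|e [C [a Ca]]]; first by exists (fun=> m).
by exists a; rewrite /= Ca; have [r _ _] := hE e; exact: r.
Qed.

Lemma represents_inj (z : hyp_sort L I) (a : tuple_in (hyp_block E z) M)
    (c c' : hyp_dom E M z) : represents a c -> represents a c' -> c = c'.
Proof.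
case: z a c c' => [s|e] a /= c c'; first by move=> -> ->.
move: c c' => [C [b Cb]] [C' [b' Cb']] /=; subst C C' => /= ba b'a.
apply: eq_exist; have [_ sym trans] := hE e; apply/seteqP.
split=> d /= bd.
  exact: trans _ _ _ b'a (trans _ _ _ (sym _ _ ba) bd).
exact: trans _ _ _ ba (trans _ _ _ (sym _ _ b'a) bd).
Qed.

Section InducedHom.
Variables (f g : hom M M).
Hypotheses (fK : forall s, cancel (f s) (g s)) (gK : forall s, cancel (g s) (f
    s)).

Let gfK (V : ctx (lsort L)) (a : tuple_in V M) :
  (fun v => g _ (f _ (a v))) = a.
Proof. by apply/functional_extensionality_dep => v; rewrite fK. Qed.

(** The image of a class under [f] is written as its preimage under [g]. It is again a class because
    both maps preserve positive formulas. *)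
Lemma hyp_class_subproof (e : I) (C : tdclass M (E e)) :
  exists a, [set b : tuple_in (tdctx (E e)) M | sval C (fun v => g _ (b v))]
    = [set b | tdint a b].
Proof.
case: C => C [a Ca] /=; exists (fun v => f _ (a v)); subst C.
have sumE (h : hom M M) (x y : tuple_in (tdctx (E e)) M) :
    (fun v => h _ (tuple_sum x y v)) =
    tuple_sum (fun v => h _ (x v)) (fun v => h _ (y v)).
  by apply/functional_extensionality_dep; case.
apply/seteqP; split=> b /= ab phi /ab /=.
  move=> /(hom_sat f); rewrite sumE.
  have -> // : (fun v => f _ (g _ (b v))) = b.
  by apply/functional_extensionality_dep => v; rewrite gK.
by move=> /(hom_sat g); rewrite sumE gfK.
Qed.

Definition hyp_hmap (z : hyp_sort L I) : hyp_dom E M z -> hyp_dom E M z :=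
  match z return hyp_dom E M z -> hyp_dom E M z with
  | inl s => f s
  | inr e => fun C => exist _ _ (hyp_class_subproof C)
  end.

Lemma represents_hmap (z : hyp_sort L I) (a : tuple_in (hyp_block E z) M)
    (c : hyp_dom E M z) :
  represents a c -> represents (fun v => f _ (a v)) (hyp_hmap c).
Proof. by case: z a c => [s|e] a c /= => [->//|]; rewrite gfK. Qed.

Lemma hyp_hom : exists h : hom (hyp_structure E M) (hyp_structure E M),
  forall z, h z = @hyp_hmap z.
Proof.
have h_fint (F : lfunc (hyp_sig E)) (a : forall i, hyp_structure E M (@fsort
    (hyp_sig E) F i)) :
    hyp_hmap (fint (s := hyp_structure E M) (f := F) a : hyp_structure E M _) =
    fint (s := hyp_structure E M) (f := F) (fun i => hyp_hmap (a i)).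
  exact: (hom_fint f).
have h_rint (R : lrel (hyp_sig E)) (a : forall i, hyp_structure E M (@rsort
    (hyp_sig E) R i)) :
    rint (s := hyp_structure E M) (r := R) a ->
    rint (s := hyp_structure E M) (r := R) (fun i => hyp_hmap (a i)).
  case: R a => [r|R] a; first exact: (hom_rint f).
  move=> [b [ba bR]]; exists (fun v => f _ (b v)); split; last exact: hom_sat.
  by move=> i; apply: (represents_hmap (ba i)).
by exists (@Hom (hyp_sig E) (hyp_structure E M) (hyp_structure E M) (@hyp_hmap)
    h_fint h_rint).
Qed.

End InducedHom.


Definition hyp_params (B : set (elem (hyp_structure E M))) : ctx (lsort L) :=
  @Ctx _ {b : set_type B & hyp_block E (projT1 (sval b))}
    (fun v => vsort (projT2 v)).

Lemma represents_tuple (V : Type) (s : V -> hyp_sort L I)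
    (c : forall v, hyp_dom E M (s v)) :
  exists a : tuple_in (@Ctx _ {v : V & hyp_block E (s v)} (fun p => vsort
      (projT2 p))) M,
  forall v, represents (fun w : hyp_block E (s v) => a (existT _ v w)) (c v).
Proof.
have /dchoice[a aP] := fun v => represents_exists (c v).
by exists (fun p => a (projT1 p) (projT2 p)).
Qed.

(** Homogeneity gives an automorphism that sends [a] to [a'] and fixes [p]. The induced map fixes
    [B] pointwise and sends [c] to [c'], and homomorphisms preserve positive formulas. *)
Lemma homogeneous_hyp_type (K : Type) : homogeneous K M ->
  forall (n : nat) (s : 'I_n -> lsort (hyp_sig E))
    (B : set (elem (hyp_structure E M))) (c c' : tuple_in (fctx s)
        (hyp_structure E M))
    (a a' : tuple_in (hyp_real E s) M) (p : tuple_in (hyp_params B) M),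
  small K (ctx_sum (hyp_real E s) (hyp_params B)) ->
  (forall i, represents (fun w : hyp_block E (s i) => a (existT _ i w)) (c i))
      ->
  (forall i, represents (fun w : hyp_block E (s i) => a' (existT _ i w)) (c'
      i)) ->
  (forall b : set_type B, represents
    (fun w : hyp_block E (projT1 (sval b)) => p (existT _ b w)) (projT2 (sval
        b))) ->
  (forall theta : pform (ctx_sum (hyp_real E s) (hyp_params B)),
     sat theta (tuple_sum a p) <-> sat theta (tuple_sum a' p)) ->
  tp B c `<=` tp B c'.
Proof.
move=> homM n s B c c' a a' p Ksmall ac a'c' pP aa'.
have [f [g fgK] fE] := homM _ Ksmall _ _ aa'.
have [h hE'] := hyp_hom (fun s => (fgK s).1) (fun s => (fgK s).2).
have hc (i : 'I_n) : h (s i) (c i) = c' i.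
  apply: represents_inj (a'c' i); rewrite hE'.
  suff <- : (fun w : hyp_block E (s i) => f _ (a (existT _ i w))) =
      fun w => a' (existT _ i w) by exact: represents_hmap (ac i).
  by apply/functional_extensionality_dep => w; exact: (fE (inl (existT _ i w))).
have hp (b : set_type B) : h _ (projT2 (sval b)) = projT2 (sval b).
  apply: represents_inj (pP b); rewrite hE'.
  suff e : (fun w => f _ (p (existT _ b w))) = fun w => p (existT _ b w).
    by rewrite -[X in represents X]e; exact: represents_hmap (pP b).
  by apply/functional_extensionality_dep => w; exact: (fE (inr (existT _ b w))).
move=> phi /(hom_sat h); rewrite /tp /= /sat_over.
have -> // : (fun v => h _ (tuple_sum c (@param_val _ _ B) v)) =
  tuple_sum c' (@param_val _ _ B).
by apply/functional_extensionality_dep => -[i|b]; [exact: hc|exact: hp].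
Qed.

(** * Translation of real formulas into the expanded language *)

Lemma translate_term (V : ctx (lsort L)) (W : ctx (lsort (hyp_sig E)))
    (r : forall v : V, @term (hyp_sig E) W (inl (vsort v)))
    (s : lsort L) (t : term V s) :
  exists t' : @term (hyp_sig E) W (inl s),
  forall b : tuple_in W (hyp_structure E M),
    eval b t' = eval (M := M) (fun v => eval b (r v)) t.
Proof.
elim: t => [v|f t /dchoice[t' tE]]; first by exists (r v).
exists (@TFun (hyp_sig E) W f t') => b /=; congr fint.
by apply/functional_extensionality_dep => i; exact: tE.
Qed.

(** Only symbols of [L] and quantifiers over real sorts are produced, and there the two structures
    coincide. *)
Lemma translate_form (V : ctx (lsort L)) (phi : pform V) :
  forall (W : ctx (lsort (hyp_sig E)))
    (r : forall v : V, @term (hyp_sig E) W (inl (vsort v))),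
  exists phi' : @pform (hyp_sig E) W,
  forall b : tuple_in W (hyp_structure E M),
    sat phi' b <-> sat (M := M) phi (fun v => eval b (r v)).
Proof.
elim: phi => {V} [V|V|V s t u|V r t|V phi IH1 psi IH2|V phi IH1 psi IH2|V s phi
    IH] W q.
- by exists (@PTop (hyp_sig E) W).
- by exists (@PBot (hyp_sig E) W).
- have [[t' tE] [u' uE]] := (translate_term q t, translate_term q u).
  by exists (@PEq (hyp_sig E) W (inl s) t' u') => b /=; rewrite tE uE.
- have /dchoice[t' tE] := fun i => translate_term q (t i).
  exists (@PRel (hyp_sig E) W (inl r) t') => b /=.
  have -> // : (fun i => eval b (t' i)) =
    (fun i => eval (M := M) (fun v => eval b (q v)) (t i)).
  by apply/functional_extensionality_dep => i; exact: tE.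
- have [[phi' phiE] [psi' psiE]] := (IH1 W q, IH2 W q).
  by exists (PAnd phi' psi') => b /=; rewrite phiE psiE.
- have [[phi' phiE] [psi' psiE]] := (IH1 W q, IH2 W q).
  by exists (POr phi' psi') => b /=; rewrite phiE psiE.
- have /dchoice[q' qE] := fun v => weaken_term (L := hyp_sig E) (inl s) (q v).
  have [phi' phiE] := IH (@ctx_ext (lsort (hyp_sig E)) W (inl s)) (fun o :
      option V =>
    match o return @term (hyp_sig E) (@ctx_ext (lsort (hyp_sig E)) W (inl s))
      (inl (vsort (c := ctx_ext V s) o)) with
    | Some v => q' v
    | None => @TVar (hyp_sig E) (@ctx_ext (lsort (hyp_sig E)) W (inl s)) None
        end).
  exists (@PEx (hyp_sig E) W (inl s) phi') => b /=.
  suff dE (d : M s) : sat phi' (tuple_ext (M := hyp_structure E M) (s := inl s)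
      b d) <->
      sat phi (tuple_ext (fun v => eval b (q v) : M (vsort v)) d).
    by split=> -[d /dE]; exists d.
  rewrite phiE; set u := (fun v => _); set u' := tuple_ext _ _.
  suff -> : u = u' by [].
  by apply/functional_extensionality_dep => -[v|] //; exact: qE.
Qed.

Lemma hyp_card_stable (lam : Type) :
  card_stable lam (hyp_structure E M) -> card_stable lam M.
Proof.
move=> st B Blam n s.
pose lift (m : elem M) : elem (hyp_structure E M) :=
  existT (hyp_dom E M) (inl (projT1 m)) (projT2 m).
pose B' := lift @` B.
have B'lam : B' #<= [set: lam] by apply: card_le_trans (card_image_le _ _) Blam.
have /card_le_embeds := st B' B'lam n (fun i => inl (s i) : lsort (hyp_sig E)).
move=> st'; apply/card_le_embeds; apply: embeds_trans st'.
have /choice[a aE] : forall t : set_type (range (@tp L M B (fctx s))),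
    exists a : tuple_in (fctx s) M, tp B a = sval t.
  by move=> [t tP] /=; have [a _ <-] := set_mem tP; exists a.
pose a' t : tuple_in (@fctx (lsort (hyp_sig E)) n (fun i => inl (s i)))
    (hyp_structure E M) := a t.
exists (fun t => SigSub (mem_set (imageT (tp B') (a' t)))) => t u /(congr1 val)
    /= tu.
suff sub t' u' : tp B' (a' t') = tp B' (a' u') -> tp B (a t') `<=` tp B (a u').
  by apply: val_inj; rewrite /= -!aE; apply/seteqP; split; apply: sub.
move=> e phi.
pose Z := ctx_sum (@fctx (lsort (hyp_sig E)) n (fun i => inl (s i))) (param_ctx
    B').
pose q (b : set_type B) : param_ctx B' :=
  SigSub (mem_set (imageP lift (set_mem (svalP b)))).
have [phi' phiE] := translate_form phi (W := Z)
  (fun v : ('I_n + set_type B)%type =>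
    match v return @term (hyp_sig E) Z
      (inl (vsort (c := ctx_sum (fctx s) (param_ctx B)) v)) with
    | inl i => @TVar (hyp_sig E) Z (inl i)
    | inr b => @TVar (hyp_sig E) Z (inr (q b)) end).
have tpE w : tp B' (a' w) phi' <-> tp B (a w) phi.
  rewrite /tp /= /sat_over phiE; set x := (fun v => _); set y := tuple_sum _ _.
  by suff -> : x = y by []; apply/functional_extensionality_dep; case.
by move=> /tpE; rewrite e => /tpE.
Qed.

End Hyperimaginaries.

(* K is the degree of saturation of the monster model M, chosen above all the
   data: the signature, the family E and all the tuples of variables in E. *)
Theorem theorem7p20 (L : signature) (T : theory L) (hT : JCP T)
    (K : Type) (hK : strong_limit K)
    (hL : small K (lsort L + lfunc L + lrel L)%type)
    (M : structure L) (hM : monster K T M)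
    (I : Type) (E : I -> tdrel L)
    (hI : small K I) (hV : small K {i : I & var (tdctx (E i))})
    (hE : forall i : I, Equivalence (@tdint L M (E i))) :
  stable K T M <-> stable K (hyp_theory E M) (hyp_structure E M).
Proof.
have [pcM satM homM] := hM; have [Kn Kset] := hK.
split=> [[_ [lam [lamI Klam stM]]]|[_ [lam [lamI Klam stE]]]]; last first.
  by split; [exact: pcM.1|exists lam; split=> //; exact: hyp_card_stable stE].
split; first by [].
(* [W] bounds the language and the representatives of finite tuples; the summand [nat] makes it
   infinite. *)
pose W : Type := (nat + (lsort L + lfunc L + lrel L + {i : I & var (tdctx (E
    i))}))%type.
have natW : embeds nat W by exists inl => x y [].
have KW : small K W by do 2 apply: small_sum => //.
have LW : embeds (lsort L + lfunc L + lrel L) W by exists (inr \o inl) => x y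
    [].
have natSW : embeds nat (set W) by exact: embeds_trans (embeds_set1 W).
have blockW (A : Type) (z : A -> hyp_sort L I) (W' : Type) : embeds A W' ->
    embeds W W' -> embeds nat W' -> embeds {x : A & hyp_block E (z x)} W'.
  move=> AW WW' natW'; apply: embeds_trans (embeds_square natW').
  apply: embeds_trans (embeds_prod AW WW').
  (* A real block has a single variable, so one code is enough; the blocks of classes are parts of
     the last summand of [W]. *)
  pose blk y : hyp_block E y -> W := match y return hyp_block E y -> W with
    | inl _ => fun=> inl 0
    | inr e => fun v => inr (inr (existT (fun i => var (tdctx (E i))) e v)) end.
  have blkI y : injective (blk y).
    case: y => [s0|e] v w vw; first by case: v w {vw} => -[].
    exact: existT_inj (congr1 (fun y : W =>
      if y is inr (inr q) then q else existT _ e v) vw).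
  exists (fun p => (projT1 p, blk _ (projT2 p))) => -[x v] [x' v'] /= [xx'].
  by subst x' => /blkI ->.
(* The new cardinal is [set W], small because [K] is a strong limit; it bounds both the parameters
   and the codes of types. *)
exists (set W); split; [exact/infiniteP/embedsP|exact: Kset|] => B BW n s.
have ordW : embeds 'I_n W.
  by apply: embeds_trans natW; exists (@nat_of_ord n); exact: val_inj.
have XW : embeds (hyp_real E s) W by apply: blockW => //; exact: embeds_refl.
have PW : embeds (hyp_params B) (set W).
  by apply: blockW => //; [exact/card_le_embeds|exact: embeds_set1].
have KX : small K (hyp_real E s) := small_embeds XW KW.
have KP : small K (hyp_params B) := small_embeds PW (Kset _ KW).
have [p pP] := represents_tuple hE (fun b : set_type B => projT2 (sval b)).
have [Y [code [YW codeP]]] := stable_few_types hK pcM satM lamI Klam stM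
  natW LW KX XW PW p.
have /choice[a aP] : forall c : tuple_in (fctx s) (hyp_structure E M),
    exists a : tuple_in (hyp_real E s) M, forall i,
    represents (fun w : hyp_block E (s i) => a (existT _ i w)) (c i).
  by move=> c; exact: represents_tuple.
have /choice[c cE] : forall t : set_type (range (tp B (X := fctx s))),
    exists c, tp B c = sval t.
  by move=> [t tP] /=; have [c _ <-] := set_mem tP; exists c.
apply/card_le_embeds; apply: embeds_trans YW.
exists (fun t => code (a (c t))) => t u tu.
have sub t' u' : code (a (c t')) = code (a (c u')) -> tp B (c t') `<=` tp B (c
    u').
  move=> e; apply: (homogeneous_hyp_type hE homM _ (aP _) (aP _) pP).
    exact: small_sum.
  by move=> theta; split; apply: codeP.
by apply: val_inj; rewrite /= -!cE; apply/seteqP; split; apply: sub.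
Qed.
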